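(* For every positive integer $\ell$, the elements \[ \Omega_{\ell,v,i}(v)=\prod_{n=0}^{\infty}\Big(1-\frac{(\theta-\varepsilon)^{q^{\ell n+i}}}{\theta-\varepsilon^{q^{\ell n+i}}}\Big)\in k_v^\times,\qquad 0<i\leq\ell, \] are algebraically independent over $\bar k$.
   Context: $q$ is a power of a prime $p$, $k=\mathbb{F}_q(\theta)$, $v\in\mathbb{F}_q[\theta]$ monic irreducible of degree $d$, $k_v$ the completion of $k$ at $v$, $\varepsilon=\lim_{i\to\infty}\theta^{q^{id}}\in k_v$ the Teichmüller lift of $\theta\bmod v$, $\mathbb{C}_v$ the completion of an algebraic closure of $k_v$, and $\bar k$ the algebraic closure of $k$ in $\mathbb{C}_v$. *)

(* Defs.v *)
From HB Require Import structures.
From mathcomp Require Import all_boot all_order all_algebra.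
From mathcomp Require Import classical_sets reals topology normedtype.
From mathcomp Require Import (canonicals) mpoly.

Set Implicit Arguments.
Unset Strict Implicit.
Unset Printing Implicit Defensive.

Import Order.TTheory GRing.Theory Num.Theory.
Import numFieldNormedType.Exports.

Local Open Scope classical_set_scope.
Local Open Scope ring_scope.

Section AbsoluteValues.
Variable R : realType.

Definition nonarch_abs (K : fieldType) (N : K -> R) : Prop :=
  [/\ forall x, 0 <= N x,
      forall x, N x = 0 <-> x = 0,
      forall x y, N (x * y) = N x * N y
    & forall x y, N (x + y) <= Num.max (N x) (N y)].

Definition tends_to (K : fieldType) (N : K -> R) (u : nat -> K) (l : K) : Prop :=
  (fun n => N (u n - l)) @ \oo --> (0 : R).

(* Limits are unique; the value is 0 if the sequence does not converge. *)
Definition lim_abs (K : fieldType) (N : K -> R) (u : nat -> K) : K :=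
  xget 0 [set l | tends_to N u l].

Definition cauchy_seq (K : fieldType) (N : K -> R) (u : nat -> K) : Prop :=
  forall e : R, 0 < e ->
    exists n0 : nat, forall m n, (n0 <= m)%N -> (n0 <= n)%N -> N (u m - u n) < e.

Definition complete_abs (K : fieldType) (N : K -> R) : Prop :=
  forall u : nat -> K, cauchy_seq N u -> exists l, tends_to N u l.

(* These conditions determine (L, NL, j) up to unique isometric isomorphism
   over (K, NK); completions enter as arbitrary models of them. *)
Definition is_completion (K L : fieldType) (NK : K -> R) (NL : L -> R)
    (j : {rmorphism K -> L}) : Prop :=
  [/\ nonarch_abs NL,
      forall x, NL (j x) = NK x,
      complete_abs NL
    & forall (y : L) (e : R), 0 < e -> exists x : K, NL (y - j x) < e].

(* When (K, NK) is complete, NL is the unique extension of NK to L. *)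
Definition is_valued_alg_closure (K : fieldType) (L : closedFieldType)
    (NK : K -> R) (NL : L -> R) (j : {rmorphism K -> L}) : Prop :=
  [/\ nonarch_abs NL,
      forall x, NL (j x) = NK x
    & forall y : L, algebraicOver j y].

End AbsoluteValues.

Section VAdic.
Variables (R : realType) (F : finFieldType) (v : {poly F}).

Definition deg_poly : nat := (size v).-1.

(* Exponent of v in a, for a != 0 and v nonconstant: v ^+ n %| a then forces
   n < size a. *)
Definition ord_poly (a : {poly F}) : nat :=
  \max_(n < size a | v ^+ n %| a) n.

(* |a / b|_v = q ^ (deg v * (ord_v b - ord_v a)), with q = #|F|. *)
Definition vadic_abs (x : {fraction {poly F}}) : R :=
  let a := \n_(repr x) in let b := \d_(repr x) in
  let c : R := (#|F| ^ deg_poly)%N%:R in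
  if a == 0 then 0 else c ^+ ord_poly b / c ^+ ord_poly a.

Variables (kv : fieldType) (N : kv -> R)
          (j : {rmorphism {fraction {poly F}} -> kv}).

Definition theta : kv := j (FracField.tofrac 'X).

Definition teichmuller : kv :=
  lim_abs N (fun i => theta ^+ (#|F| ^ (i * deg_poly))%N).

Definition Omega_partial (l i m : nat) : kv :=
  \prod_(0 <= n < m)
    (1 - (theta - teichmuller) ^+ (#|F| ^ (l * n + i))%N
         / (theta - teichmuller ^+ (#|F| ^ (l * n + i))%N)).

Definition Omega (l i : nat) : kv := lim_abs N (Omega_partial l i).

End VAdic.

(* S is meant to be a subfield of L. *)
Definition alg_independent_over (L : fieldType) (S : L -> Prop) (n : nat)
    (x : 'I_n -> L) : Prop :=
  forall P : mpoly.mpoly n L,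
    (forall m, S (mpoly.mcoeff m P)) -> mpoly.meval x P = 0 -> P = 0.

(* Main.v *)
(** Put x = theta - eps and Q = q^(d l), so that |x| < 1 and eps^Q = eps.  Grouping
    the factors according to n mod d, each Omega_i is a product of d of the elements
      omega_j = prod_m (1 - x^(k_j Q^m) / (x - delta_j)),
    where k_j runs through q^1, ..., q^(d l) and delta_j lies in a finite field, and
    one shows that all omega_j are algebraically independent over the rational
    functions in x.  The idea is to treat the x in the denominators as a second
    variable t: after raising to a power of Q, omega_j becomes the value at
    t = x^(Q^n) of F_j(t) = prod_(m >= N) (1 - x^(k_j Q^m) / (t - delta_j)) times a
    rational function, and replacing x by x^Q only removes one factor of F_j.

    Suppose that sum_a c_a omega^(nu_a) = 0.  Linear algebra over the finite field
    yields polynomials P_a in x and t, of t-degree somewhat less than N and x-degree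
    O(Q^N), whose vector of values at t = x^(Q^n) is proportional to that of the
    relation for every n < N; then sum_a P_a F^(nu_a) vanishes at these N points and
    is therefore, by a Schwarz lemma on the complement of small discs around the
    points of the finite field, very small.  So is the Casorati determinant of the
    P_a, a polynomial in x and t with x-degree O(Q^N), which has to vanish.  But it
    is nonzero, because the monomials F^(nu_a) satisfy inequivalent difference
    equations of order one with respect to x -> x^Q, as one sees on their zeros. *)

From HB Require Import structures.
Require Import Defs.
From mathcomp Require Import all_boot all_order all_algebra finfield.
From mathcomp Require Import reals ring zify.
From mathcomp Require Import (canonicals, coercions) mpoly.

Set Implicit Arguments.
Unset Strict Implicit.
Unset Printing Implicit Defensive.

Import Order.TTheory GRing.Theory Num.Theory.
Local Open Scope ring_scope.

(** * Non-archimedean absolute values and Gauss norms *)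

Section NonArchimedean.
Variables (R : realType) (K : fieldType) (N : K -> R).
Hypothesis absN : nonarch_abs N.

Lemma abs_ge0 x : 0 <= N x.
Proof. by case: absN. Qed.

Lemma abs_eq0 x : (N x == 0) = (x == 0).
Proof. by case: absN => _ h _ _; apply/eqP/eqP => /h. Qed.

Lemma abs0 : N 0 = 0.
Proof. by apply/eqP; rewrite abs_eq0. Qed.

Lemma absM x y : N (x * y) = N x * N y.
Proof. by case: absN. Qed.

Lemma abs_gt0 x : (0 < N x) = (x != 0).
Proof. by rewrite lt_def abs_eq0 abs_ge0 andbT. Qed.

Lemma abs1 : N 1 = 1.
Proof.
have h : N 1 != 0 by rewrite abs_eq0 oner_eq0.
by apply: (mulfI h); rewrite -absM !mulr1.
Qed.

Lemma absX x n : N (x ^+ n) = N x ^+ n.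
Proof. by elim: n => [|n IH]; rewrite ?expr0 ?abs1 // !exprS absM IH. Qed.

Lemma abs_root1 x n : (0 < n)%N -> x ^+ n = 1 -> N x = 1.
Proof.
move=> n0 h; apply/eqP; rewrite -(@pexpr_eq1 _ _ n) // ?abs_ge0 //.
by rewrite -absX h abs1.
Qed.

Lemma absN1 : N (- 1) = 1.
Proof. by apply: (@abs_root1 _ 2) => //; rewrite sqrrN expr1n. Qed.

Lemma absNE x : N (- x) = N x.
Proof. by rewrite -mulN1r absM absN1 mul1r. Qed.

Lemma absB x y : N (x - y) = N (y - x).
Proof. by rewrite -absNE opprB. Qed.

Lemma absV x : N x^-1 = (N x)^-1.
Proof.
have [->|x0] := eqVneq x 0; first by rewrite invr0 abs0 invr0.
have h : N x != 0 by rewrite abs_eq0.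
by apply: (mulfI h); rewrite -absM !mulfV // abs1.
Qed.

Lemma abs_div x y : N (x / y) = N x / N y.
Proof. by rewrite absM absV. Qed.

Lemma absD_le x y C : N x <= C -> N y <= C -> N (x + y) <= C.
Proof.
move=> hx hy; have [_ _ _ h] := absN.
by apply: (le_trans (h x y)); rewrite ge_max hx.
Qed.

Lemma absB_le x y C : N x <= C -> N y <= C -> N (x - y) <= C.
Proof. by move=> hx hy; apply: absD_le => //; rewrite absNE. Qed.

Lemma abs_sum_le I (r : seq I) (P : pred I) (f : I -> K) C :
  0 <= C -> (forall i, P i -> N (f i) <= C) -> N (\sum_(i <- r | P i) f i) <= C.
Proof.
move=> C0 h; elim/big_rec: _ => [|i x Pi hx]; first by rewrite abs0.
by apply: absD_le => //; apply: h.
Qed.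

Lemma abs_prod I (r : seq I) (P : pred I) (f : I -> K) :
  N (\prod_(i <- r | P i) f i) = \prod_(i <- r | P i) N (f i).
Proof. by apply: (big_morph N absM abs1). Qed.

Lemma abs_addl x y : N y < N x -> N (x + y) = N x.
Proof.
move=> h; apply/eqP; rewrite eq_le; apply/andP; split.
  by apply: absD_le => //; apply: ltW.
rewrite leNgt; apply/negP => h2.
have : N x < N x.
  have e : x = (x + y) - y by rewrite addrK.
  rewrite {1}e; have [_ _ _ hh] := absN.
  by apply: le_lt_trans (hh _ _) _; rewrite absNE gt_max h2.
by rewrite ltxx.
Qed.

(* The Gauss norm of [f] on the closed disc of centre [c] and radius [r] is at
   most [C]. *)
Definition disc_le (c : K) (r C : R) (f : {poly K}) : Prop :=
  forall k, N ((f \Po ('X + c%:P))`_k) * r ^+ k <= C.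

Section Disc.
Variables (c : K) (r : R).
Hypothesis r_gt0 : 0 < r.

Lemma disc_le_ge0 C f : disc_le c r C f -> 0 <= C.
Proof. by move=> /(_ 0%N); rewrite expr0 mulr1; apply: le_trans; apply: abs_ge0. Qed.

Lemma disc_leW C C' f : C <= C' -> disc_le c r C f -> disc_le c r C' f.
Proof. by move=> h hf k; apply: le_trans (hf k) h. Qed.

Lemma disc_leC C a : N a <= C -> disc_le c r C a%:P.
Proof.
move=> h k; rewrite comp_polyC coefC; case: eqP => [->|_].
  by rewrite expr0 mulr1.
by rewrite abs0 mul0r; apply: le_trans h; apply: abs_ge0.
Qed.

Lemma disc_leD C f g : disc_le c r C f -> disc_le c r C g -> disc_le c r C (f + g).
Proof.
move=> hf hg k; rewrite comp_polyD coefD -ler_pdivlMr ?exprn_gt0 //.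
by apply: absD_le; rewrite ler_pdivlMr ?exprn_gt0.
Qed.

Lemma disc_leN C f : disc_le c r C f -> disc_le c r C (- f).
Proof.
move=> hf k; rewrite -[- f]mulN1r -polyCN mul_polyC comp_polyZ coefZ mulN1r absNE.
exact: hf.
Qed.

Lemma disc_leB C f g : disc_le c r C f -> disc_le c r C g -> disc_le c r C (f - g).
Proof. by move=> hf hg; apply: disc_leD => //; apply: disc_leN. Qed.

Lemma disc_le_sum C I (s : seq I) (P : pred I) (f : I -> {poly K}) : 0 <= C ->
  (forall i, P i -> disc_le c r C (f i)) -> disc_le c r C (\sum_(i <- s | P i) f i).
Proof.
move=> C0 h; elim/big_rec: _ => [|i x Pi hx]; last by apply: disc_leD => //; apply: h.
by rewrite -polyC0; apply: disc_leC; rewrite abs0.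
Qed.

Lemma disc_leM C C' f g :
  disc_le c r C f -> disc_le c r C' g -> disc_le c r (C * C') (f * g).
Proof.
move=> hf hg k; rewrite comp_polyM coefM -ler_pdivlMr ?exprn_gt0 //.
have C0 := disc_le_ge0 hf; have C'0 := disc_le_ge0 hg.
apply: abs_sum_le => [|i _].
  by rewrite divr_ge0 ?mulr_ge0 // exprn_ge0 // ltW.
have ik : (i <= k)%N by rewrite -ltnS.
rewrite ler_pdivlMr ?exprn_gt0 // absM.
have -> : r ^+ k = r ^+ i * r ^+ (k - i) by rewrite -exprD subnKC.
rewrite mulrACA.
by apply: ler_pM => //; rewrite mulr_ge0 ?abs_ge0 ?exprn_ge0 // ltW.
Qed.

Lemma disc_leX C f n : disc_le c r C f -> disc_le c r (C ^+ n) (f ^+ n).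
Proof.
move=> hf; elim: n => [|n IH]; last by rewrite !exprS; apply: disc_leM.
by rewrite !expr0; apply: disc_leC; rewrite abs1.
Qed.

Lemma disc_le_prod I (s : seq I) (P : pred I) (C : I -> R) (f : I -> {poly K}) :
  (forall i, P i -> disc_le c r (C i) (f i)) ->
  disc_le c r (\prod_(i <- s | P i) C i) (\prod_(i <- s | P i) f i).
Proof.
move=> h; elim/big_rec2: _ => [|i y x Pi hx].
  by apply: disc_leC; rewrite abs1.
by apply: disc_leM => //; apply: h.
Qed.

Lemma disc_le_prod1 (I : eqType) (s : seq I) (f : I -> {poly K}) :
  {in s, forall i, disc_le c r 1 (f i)} -> disc_le c r 1 (\prod_(i <- s) f i).
Proof.
elim: s => [|i s IH] h; first by rewrite big_nil; apply: disc_leC; rewrite abs1.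
rewrite big_cons -[1]mul1r; apply: disc_leM; first by apply: h; rewrite mem_head.
by apply: IH => j js; apply: h; rewrite inE js orbT.
Qed.

Lemma shift_XsubC t : ('X - t%:P) \Po ('X + c%:P) = 'X + (c - t)%:P.
Proof. by rewrite comp_polyB comp_polyX comp_polyC polyCB addrA. Qed.

Lemma disc_le_XsubC C t : N (c - t) <= C -> r <= C -> disc_le c r C ('X - t%:P).
Proof.
move=> h1 h2 k; rewrite shift_XsubC coefD coefX coefC.
have C0 : 0 <= C by apply: le_trans h1; apply: abs_ge0.
case: k => [|[|k]] /=; first by rewrite add0r expr0 mulr1.
  by rewrite addr0 abs1 mul1r expr1.
by rewrite addr0 abs0 mul0r.
Qed.

(** The Taylor coefficients at [c] of the quotient satisfy a recursion in which [c - t] dominates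
    [r]; solving it upwards from the constant term loses only the factor [N (c - t)]. *)
Lemma disc_le_divl C t f : r <= N (c - t) ->
  disc_le c r C (('X - t%:P) * f) -> disc_le c r (C / N (c - t)) f.
Proof.
move=> ht hf; have t0 : 0 < N (c - t) by apply: lt_le_trans ht.
elim=> [|k IH].
  rewrite ler_pdivlMr //; have := hf 0%N; rewrite comp_polyM shift_XsubC.
  by rewrite mulrDl coefD coefXM add0r coefCM absM !expr0 !mulr1 mulrC.
have := hf k.+1; rewrite comp_polyM shift_XsubC.
rewrite mulrDl coefD coefXM coefCM /=.
set h := f \Po _ in IH *.
move=> hk; rewrite ler_pdivlMr // mulrAC.
have -> : N h`_k.+1 * N (c - t) = N ((h`_k + (c - t) * h`_k.+1) - h`_k).
  by rewrite addrAC subrr add0r absM mulrC.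
rewrite -ler_pdivlMr ?exprn_gt0 //; apply: absB_le; rewrite ler_pdivlMr ?exprn_gt0 //.
rewrite ler_pdivlMr // in IH; apply: le_trans IH.
rewrite exprSr mulrA; apply: ler_wpM2l => //.
by rewrite mulr_ge0 ?abs_ge0 ?exprn_ge0 // ltW.
Qed.

(** Here [r] dominates [N (c - t)], so the same recursion is solved downwards from the top
    coefficient. *)
Lemma disc_le_divr C t f : N (c - t) <= r ->
  disc_le c r C (('X - t%:P) * f) -> disc_le c r (C / r) f.
Proof.
move=> ht hf; have C0 := disc_le_ge0 hf; set h := f \Po ('X + c%:P).
suff H n k : (size h <= k + n)%N -> N h`_k * r ^+ k <= C / r.
  by move=> k; apply: (H (size h)); apply: leq_addl.
elim: n k => [|n IH] k hk.
  rewrite addn0 in hk; rewrite (nth_default _ hk) abs0 mul0r divr_ge0 // ltW //.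
have hk1 := IH k.+1; rewrite addSnnS in hk1; have {}hk1 := hk1 hk.
rewrite ler_pdivlMr // -mulrA -exprSr.
have := hf k.+1; rewrite comp_polyM shift_XsubC mulrDl coefD coefXM coefCM /= -/h => hg.
have -> : h`_k = (h`_k + (c - t) * h`_k.+1) - (c - t) * h`_k.+1 by rewrite addrK.
rewrite -ler_pdivlMr ?exprn_gt0 //; apply: absB_le; rewrite ler_pdivlMr ?exprn_gt0 //.
rewrite absM -mulrA; apply: le_trans (ler_pM _ _ ht hk1) _; rewrite ?abs_ge0 //.
  by rewrite mulr_ge0 ?abs_ge0 ?exprn_ge0 // ltW.
by rewrite mulrC mulfVK // gt_eqF.
Qed.

Lemma disc_le_horner C f : disc_le c r C f -> N f.[c] <= C.
Proof.
move=> /(_ 0%N); rewrite expr0 mulr1 -horner_coef0 horner_comp.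
by rewrite hornerD hornerX hornerC add0r.
Qed.

End Disc.

Lemma disc_le01 C f : disc_le 0 1 C f <-> forall k, N f`_k <= C.
Proof.
by split=> h k; have := h k; rewrite /= polyC0 addr0 comp_polyXr expr1n mulr1.
Qed.

Lemma disc_le_unit c r C f : 0 < r -> r <= 1 -> N c <= 1 ->
  disc_le 0 1 C f -> disc_le c r C f.
Proof.
move=> r0 r1 c1 hf; have C0 := disc_le_ge0 hf; move/disc_le01: hf => hf.
rewrite -[f]coefK poly_def; apply: disc_le_sum => // i _.
rewrite -mul_polyC -[C]mulr1 -(expr1n _ i); apply: disc_leM => //; first exact: disc_leC.
apply: disc_leX => //; rewrite -['X]subr0 -polyC0; apply: disc_le_XsubC => //.
by rewrite subr0.
Qed.

(** Newton's divided differences: each node costs one division by a difference of absolute value at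
    least [eta]. [I] is the interpolation polynomial. *)
Lemma newton_interpolation eta : 0 < eta -> eta <= 1 ->
  forall (s : seq K) C (G : {poly K}), uniq s -> 0 <= C ->
  {in s, forall t, N t <= 1} -> {in s &, forall t t', t != t' -> eta <= N (t - t')} ->
  {in s, forall t, N G.[t] <= C} ->
  exists I H, [/\ G = I + (\prod_(t <- s) ('X - t%:P)) * H,
    disc_le 0 1 (C / eta ^+ size s) I & (size I <= size s)%N].
Proof.
move=> e0 e1; elim=> [|t s IH] C G; first move=> _ C0 _ _ _.
  exists 0, G; split; first by rewrite big_nil mul1r add0r.
    by apply/disc_le01 => k; rewrite coef0 abs0 expr0 divr1.
  by rewrite size_poly0.
rewrite cons_uniq => /andP[ts us] C0 hs hd hG.
have [G1 eG1] : exists G1, G - G.[t]%:P = G1 * ('X - t%:P).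
  apply/factor_theorem.
  by rewrite rootE hornerD hornerN hornerC subrr.
have hG1 : {in s, forall t', N G1.[t'] <= C / eta}.
  move=> t' t's; have tt' : t' != t by apply: contraNneq ts => <-.
  have h := congr1 (fun p => p.[t']) eG1.
  rewrite /= hornerD hornerN hornerC hornerM hornerXsubC in h.
  have nt : t' - t != 0 by rewrite subr_eq0.
  have -> : G1.[t'] = (G.[t'] - G.[t]) / (t' - t) by rewrite h mulfK.
  rewrite abs_div; apply: ler_pM; rewrite ?invr_ge0 ?abs_ge0 //.
    by apply: absB_le; apply: hG; rewrite inE ?t's ?orbT ?eqxx.
  have := hd t' t; rewrite !inE t's eqxx orbT => /(_ isT isT tt') h'.
  by rewrite lef_pV2 // posrE ?abs_gt0.
have C1 : 0 <= C / eta by rewrite divr_ge0 // ltW.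
have [||I [H [e hI sI]]] := IH _ G1 us C1 _ _ hG1.
- by move=> t' t's; apply: hs; rewrite inE t's orbT.
- by move=> t1 t2 h1 h2; apply: hd; rewrite inE ?h1 ?h2 orbT.
exists (G.[t]%:P + ('X - t%:P) * I), H; split.
- rewrite big_cons -addrA -mulrA -mulrDr -e mulrC -eG1 addrC subrK //.
- have C2 : C / eta / eta ^+ size s = C / eta ^+ (size s).+1.
    by rewrite -mulrA -invfM -exprS.
  rewrite /= -C2; apply: disc_leD => //.
    apply: disc_leC => //; apply: le_trans (hG _ (mem_head _ _)) _.
    rewrite C2 ler_pdivlMr ?exprn_gt0 //; apply: ler_piMr => //.
    by apply: exprn_ile1 => //; apply: ltW.
  rewrite -[C / _ / _]mul1r; apply: disc_leM => //; apply: disc_le_XsubC => //.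
  by rewrite add0r absNE hs // mem_head.
apply: leq_trans (size_polyD _ _) _; rewrite geq_max (leq_trans (size_polyC_leq1 _)) //=.
apply: leq_trans (size_polyMleq _ _) _; rewrite size_XsubC /=.
exact: sI.
Qed.

(** * Bernstein and Schwarz lemmas outside small discs *)

Section Centres.
Variables (s : seq K) (r : R).
Hypotheses (r_gt0 : 0 < r) (r_le1 : r <= 1) (s_uniq : uniq s)
  (s_le1 : {in s, forall c, N c <= 1})
  (s_dist : {in s &, forall c c', c != c' -> N (c - c') = 1}).

(** On the disc about [c] only the factor ['X - c%:P] has norm [r]; all other factors have norm
    1. *)
Lemma disc_le_div_prod c C f : c \in s ->
  disc_le c r C ((\prod_(t <- s) ('X - t%:P)) * f) -> disc_le c r (C / r) f.
Proof.
move=> cs; rewrite (perm_big _ (perm_to_rem cs)) big_cons -mulrA.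
have cc : N (c - c) <= r by rewrite subrr abs0 ltW.
move/(disc_le_divr r_gt0 cc).
have h : {in rem c s, forall t, N (c - t) = 1}.
  move=> t; rewrite mem_rem_uniq // inE => /andP[tc ts].
  by rewrite s_dist // eq_sym.
move: (C / r) => {}C; elim: (rem c s) h f C => [|t s' IH] h f C.
  by rewrite big_nil mul1r.
rewrite big_cons -mulrA => /disc_le_divl; rewrite h ?mem_head // divr1.
move=> /(_ r_gt0 r_le1); apply: IH => t' t's; apply: h.
by rewrite inE t's orbT.
Qed.

(** A maximum principle outside the discs for [G] divided by the [M]-th power of the product over
    the centres. Subtracting the interpolation polynomial at the centres, which costs nothing as
    their distances are 1, and dividing by the product lowers [M] by one. *)
Lemma disc_le_bernstein M C (G : {poly K}) : 0 <= C -> (size G <= size s * M)%N ->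
  {in s, forall c, disc_le c r (C * r ^+ M) G} -> disc_le 0 1 C G.
Proof.
move=> C0; elim: M G => [|M IH] G.
  rewrite muln0 leqn0 size_poly_eq0 => /eqP-> _.
  by apply/disc_le01 => k; rewrite coef0 abs0.
move=> sG hG.
have CM0 : 0 <= C * r ^+ M.+1 by rewrite mulr_ge0 // exprn_ge0 // ltW.
have [||I [H [e]]] := @newton_interpolation 1 ltr01 (lexx 1) s _ G s_uniq CM0 s_le1.
- by move=> t t' h1 h2 /s_dist ->.
- by move=> t ts; apply: (disc_le_horner (hG t ts)).
rewrite expr1n divr1 => hI sI.
have rM : r ^+ M.+1 <= 1 by rewrite exprn_ile1 // ltW.
have hI1 : disc_le 0 1 C I.
  by apply: disc_leW hI; rewrite ler_piMr.
have pm : \prod_(t <- s) ('X - t%:P) \is monic by apply: monic_prod => t _; apply: monicXsubC.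
have eH : (\prod_(t <- s) ('X - t%:P)) * H = G - I by rewrite e addrAC subrr add0r.
have hH : disc_le 0 1 C H.
  apply: IH.
    have [->|H0] := eqVneq H 0; first by rewrite size_poly0.
    have : (size ((\prod_(t <- s) ('X - t%:P)) * H)%R <= size s * M.+1)%N.
      rewrite eH (leq_trans (size_polyD _ _)) // size_polyN geq_max sG.
      by rewrite (leq_trans sI) // mulnS leq_addr.
    by rewrite size_monicM // size_prod_XsubC addSn /= mulnS leq_add2l.
  move=> c cs; have -> : C * r ^+ M = C * r ^+ M.+1 / r.
    by rewrite exprSr mulrA mulfK // gt_eqF.
  apply: disc_le_div_prod => //; rewrite eH; apply: disc_leB => //; first exact: hG.
  by apply: disc_le_unit => //; apply: s_le1.
rewrite e; apply: disc_leD => //; rewrite -[C]mul1r; apply: disc_leM => //.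
apply: disc_le_prod1 => // t ts; apply: disc_le_XsubC => //.
by rewrite add0r absNE s_le1.
Qed.

(* Think of [G] as the numerator of a function with poles at the centres.
   Dividing by the [size s * n] approximate zeros lowers the degree by [n] blocks
   of size [size s], and each block gains a factor [r] in [disc_le_bernstein]. *)
Lemma disc_le_schwarz (ts : seq K) (n M : nat) (eta kappa C0 C1 : R)
    (G : {poly K}) :
  size ts = (size s * n)%N -> uniq ts -> 0 < eta -> eta <= 1 -> 0 <= C1 ->
  {in ts, forall t, N t <= 1} -> {in ts &, forall t t', t != t' -> eta <= N (t - t')} ->
  {in s & ts, forall c t, r <= N (c - t)} -> 0 < kappa ->
  {in s, forall c, kappa <= \prod_(t <- ts) N (c - t)} ->
  {in ts, forall t, N G.[t] <= C1} -> C1 / eta ^+ size ts <= C0 ->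
  {in s, forall c, disc_le c r C0 G} -> (size G <= size s * (n + M))%N ->
  kappa * r ^+ M <= 1 ->
  disc_le 0 1 (C0 / (kappa * r ^+ M)) G.
Proof.
move=> zts uts e0 e1 C10 t1 td st k0 hk hG hC hs sG hk1.
have C0p : 0 <= C0.
  by apply: le_trans hC; rewrite divr_ge0 // exprn_ge0 // ltW.
have rM0 : 0 < r ^+ M by rewrite exprn_gt0.
have kM0 : 0 < kappa * r ^+ M by rewrite mulr_gt0.
have [I [H [e hI sI]]] := newton_interpolation e0 e1 uts C10 t1 td hG.
have C0q : C0 <= C0 / (kappa * r ^+ M) by rewrite ler_pdivlMr // ler_piMr.
have hI0 := disc_leW hC hI.
set p := \prod_(t <- ts) ('X - t%:P) in e.
have pm : p \is monic by apply: monic_prod => t _; apply: monicXsubC.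
have eH : p * H = G - I by rewrite e addrAC subrr add0r.
rewrite e; apply: disc_leD => //; first exact: disc_leW hI0.
rewrite -[C0 / _]mul1r; apply: disc_leM => //.
  apply: disc_le_prod1 => // t tts; apply: disc_le_XsubC => //.
  by rewrite add0r absNE t1.
(* The quotient by the approximate zeros has only [M] blocks left, and [kappa] pays for the division
   on each disc. *)
apply: (@disc_le_bernstein M); first by apply: le_trans C0q.
  have [->|H0] := eqVneq H 0; first by rewrite size_poly0.
  have : (size (p * H)%R <= size s * (n + M))%N.
    rewrite eH (leq_trans (size_polyD _ _)) // size_polyN geq_max sG.
    by rewrite (leq_trans sI) // zts leq_mul2l leq_addr orbT.
  by rewrite size_monicM // size_prod_XsubC addSn /= zts mulnDr leq_add2l.
move=> c cs.
have -> : C0 / (kappa * r ^+ M) * r ^+ M = C0 / kappa.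
  by rewrite invfM mulrA mulfVK // gt_eqF.
have : disc_le c r C0 (p * H).
  by rewrite eH; apply: disc_leB; [|exact: hs|apply: disc_le_unit => //; exact: s_le1].
have : disc_le c r (C0 / \prod_(t <- ts) N (c - t)) H -> disc_le c r (C0 / kappa) H.
  apply: disc_leW; apply: ler_wpM2l => //; rewrite lef_pV2 ?posrE ?hk //.
  by apply: lt_le_trans (hk _ cs).
move=> h hp; apply: h; move: hp; rewrite /p.
have : {in ts, forall t, r <= N (c - t)} by move=> t; apply: st.
elim: (ts) C0 {C0p hC hs C0q hI0 e hI eH p pm} => [|t ts' IH] C0 hr.
  by rewrite !big_nil mul1r divr1.
rewrite !big_cons -mulrA => /disc_le_divl h.
have := IH _ _ (h r_gt0 (hr _ (mem_head _ _))); rewrite invfM mulrA; apply.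
by move=> t' h'; apply: hr; rewrite inE h' orbT.
Qed.

End Centres.

End NonArchimedean.

(** * Casoratian determinants of rank one difference modules *)

Section Casorati.
Variables (A : idomainType) (sigma : {rmorphism A -> A}) (I : finType).
Variables (gamma P : I -> A).

(** Iterates of [u -> gamma a * sigma u], which is the action of [sigma] on the coefficient [u] of a
    [y] with [sigma y = gamma a * y]. *)
Fixpoint twisted_orbit (i : nat) (a : I) : A :=
  if i is i'.+1 then gamma a * sigma (twisted_orbit i' a) else P a.

Hypothesis sigma_inj : injective sigma.
Hypothesis P_neq0 : forall a, P a != 0.
(** Inequivalence of rank one difference equations: for distinct [a], [b] the twists of
    [gamma b / gamma a] are not of the form [sigma h / h] with [h = f / g]. *)
Hypothesis gamma_neq : forall r a b f g, f != 0 -> g != 0 ->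
  iter r sigma (gamma a) * sigma f * g = iter r sigma (gamma b) * f * sigma g -> a = b.

Lemma iter_morph_eq0 r x : (iter r sigma x == 0) = (x == 0).
Proof. by elim: r => //= r <-; rewrite -{1}(rmorph0 sigma) (inj_eq sigma_inj). Qed.

Lemma iter_morphM r x y : iter r sigma (x * y) = iter r sigma x * iter r sigma y.
Proof. by elim: r => //= r ->; rewrite rmorphM. Qed.

Lemma iter_morph_sum r (T : finType) (f : T -> A) :
  iter r sigma (\sum_t f t) = \sum_t iter r sigma (f t).
Proof. by elim: r => // r IH; rewrite iterS IH rmorph_sum; apply: eq_bigr. Qed.

(* Artin's argument: the relation and its [sigma]-image can be combined to
   eliminate one of the indices. *)
Lemma twisted_orbit_free (S : {set I}) r (lambda : I -> A) :
  (forall i, (i < #|S|)%N -> \sum_(a in S) lambda a * iter r sigma (twisted_orbit i a) = 0) ->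
  {in S, forall a, lambda a = 0}.
Proof.
(* The level [r] stays general, since eliminating an index replaces it by [r.+1]. *)
have [n] := ubnP #|S|; elim: n S r lambda => // n IH S r lambda; rewrite ltnS => cS h.
have [a0 /andP[a0S l0]|h0 a aS] := pickP [pred a | (a \in S) && (lambda a != 0)]; last first.
  by have := h0 a; rewrite /= aS /= => /negbFE/eqP.
pose kap a := lambda a * iter r sigma (gamma a) * sigma (lambda a0)
              - lambda a0 * iter r sigma (gamma a0) * sigma (lambda a).
have cS1 : #|S :\ a0|.+1 = #|S| by rewrite (cardsD1 a0 S) a0S.
have hk : {in S :\ a0, forall a, kap a = 0}.
  apply: (IH _ r.+1); first by rewrite -ltnS cS1 ltnS.
  move=> i; rewrite -ltnS cS1 => iS.
  have e1 : \sum_(a in S) lambda a * iter r sigma (gamma a) *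
              iter r.+1 sigma (twisted_orbit i a) = 0.
    apply: etrans (h i.+1 iS); apply: eq_bigr => a _ /=.
    by rewrite iter_morphM -iterSr mulrA.
  have e2 : \sum_(a in S) sigma (lambda a) * iter r.+1 sigma (twisted_orbit i a) = 0.
    have := congr1 sigma (h i (ltnW iS)); rewrite rmorph0 rmorph_sum => e.
    apply: etrans e; apply: eq_bigr => a _ /=.
    by rewrite rmorphM.
  have : \sum_(a in S) kap a * iter r.+1 sigma (twisted_orbit i a) = 0.
    transitivity (sigma (lambda a0) * (\sum_(a in S) lambda a * iter r sigma (gamma a) *
        iter r.+1 sigma (twisted_orbit i a)) - lambda a0 * iter r sigma (gamma a0) *
        (\sum_(a in S) sigma (lambda a) * iter r.+1 sigma (twisted_orbit i a))).
      rewrite !mulr_sumr -sumrB; apply: eq_bigr => a _.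
      by rewrite /kap mulrBl !mulrA; congr (_ * _ - _); rewrite mulrC mulrA.
    by rewrite e1 e2 !mulr0 subr0.
  by rewrite (big_setD1 a0 a0S) /= {1}/kap subrr mul0r add0r.
have hl : {in S :\ a0, forall a, lambda a = 0}.
  move=> a aS; apply/eqP; case: eqP => // /eqP la.
  have /eqP := hk a aS; rewrite subr_eq0 => /eqP e.
  (* A second nonzero coefficient would make [lambda a0 / lambda a] an equivalence between [gamma a]
     and [gamma a0]. *)
  have ea : a = a0.
    apply: (gamma_neq (r := r) l0 la); rewrite mulrC mulrA e.
    by rewrite (mulrC (lambda a0)).
  by move: aS; rewrite ea setD11.
have := h 0%N; rewrite -cS1 => /(_ isT); rewrite (big_setD1 a0 a0S) /=.
rewrite big1 => [|a aS]; last by rewrite hl // mul0r.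
move/eqP; rewrite addr0 mulf_eq0 (negbTE l0) /= iter_morph_eq0.
by rewrite (negbTE (P_neq0 a0)).
Qed.

End Casorati.

Lemma casorati_det_neq0 (A : idomainType) (sigma : {rmorphism A -> A}) (s : nat)
    (gamma P : 'I_s -> A) :
  injective sigma -> (forall a, P a != 0) ->
  (forall r a b f g, f != 0 -> g != 0 ->
    iter r sigma (gamma a) * sigma f * g = iter r sigma (gamma b) * f * sigma g -> a = b) ->
  \det (\matrix_(i < s, a < s) twisted_orbit sigma gamma P i a) != 0.
Proof.
move=> si P0 hg; rewrite -det_tr; apply/det0P => -[v v0 hv].
case/negP: v0; apply/eqP/rowP => a; rewrite [RHS]mxE.
apply: (@twisted_orbit_free A sigma _ gamma P si P0 hg [set: 'I_s] 0 (fun a => v 0 a)) => //.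
rewrite cardsT card_ord => i lis; have /rowP/(_ (Ordinal lis)) := hv.
rewrite !mxE => e; apply: etrans e; under eq_bigl do rewrite in_setT.
by apply: eq_bigr => b _; rewrite !mxE.
Qed.

(** * The twist [x -> x^Q] on polynomials in two variables *)

Section Aux.
Variable F : idomainType.
Notation C := {poly F}.
Notation A := {poly {poly F}}.

Section Sigma.
Variable Q : nat.
Hypothesis Q_gt0 : (0 < Q)%N.
Notation sC := (comp_poly ('X^Q : C)).
Definition twist : {rmorphism A -> A} := map_poly sC.

Lemma comp_polyXn_inj : injective sC.
Proof.
apply: raddf_inj => f /eqP; rewrite comp_poly_eq0 ?size_polyXn //.
by move/eqP.
Qed.

Lemma twist_inj : injective twist.
Proof. exact: (map_inj_poly comp_polyXn_inj (rmorph0 _)). Qed.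

Lemma size_twist f : size (twist f) = size f.
Proof. exact: (size_map_inj_poly comp_polyXn_inj (rmorph0 _)). Qed.

Lemma size_iter_twist r f : size (iter r twist f) = size f.
Proof. by elim: r => //= r; rewrite size_twist. Qed.

Lemma twist_XsubC y : twist ('X - y%:P) = 'X - (sC y)%:P.
Proof. by rewrite /= rmorphB /= map_polyX map_polyC. Qed.

End Sigma.
End Aux.

Arguments twist {F} Q.

(** * Degree bounds for polynomials in two variables *)

Section DegreeBounds.
Variable R : idomainType.

Definition deg_le (n : nat) (f : {poly R}) : bool := (size f <= n.+1)%N.

Lemma deg_leW m n f : (m <= n)%N -> deg_le m f -> deg_le n f.
Proof. by rewrite /deg_le => mn /leq_trans; apply; rewrite ltnS. Qed.

Lemma deg_leC c : deg_le 0 c%:P.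
Proof. exact: size_polyC_leq1. Qed.

Lemma deg_leD n f g : deg_le n f -> deg_le n g -> deg_le n (f + g).
Proof. by move=> hf hg; apply: leq_trans (size_polyD _ _) _; rewrite geq_max; apply/andP. Qed.

Lemma deg_leN n f : deg_le n f -> deg_le n (- f).
Proof. by rewrite /deg_le size_polyN. Qed.

Lemma deg_leM m n f g : deg_le m f -> deg_le n g -> deg_le (m + n) (f * g).
Proof.
move=> hf hg; apply: leq_trans (size_polyMleq _ _) _.
by rewrite /deg_le in hf hg; have := leq_add hf hg; case: (_ + _)%N => // k; rewrite addSn addnS.
Qed.

Lemma deg_leX n f k : deg_le n f -> deg_le (n * k) (f ^+ k).
Proof.
move=> hf; elim: k => [|k IH]; first by rewrite muln0 expr0; apply: deg_leC.
by rewrite exprS mulnS; apply: deg_leM.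
Qed.

Lemma deg_le_sum n I (r : seq I) (P : pred I) (f : I -> {poly R}) :
  (forall i, P i -> deg_le n (f i)) -> deg_le n (\sum_(i <- r | P i) f i).
Proof.
move=> h; elim/big_rec: _ => [|i x Pi hx]; first by rewrite /deg_le size_poly0.
by apply: deg_leD => //; apply: h.
Qed.

Lemma deg_le_prod I (r : seq I) (P : pred I) (n : I -> nat) (f : I -> {poly R}) :
  (forall i, P i -> deg_le (n i) (f i)) ->
  deg_le (\sum_(i <- r | P i) n i) (\prod_(i <- r | P i) f i).
Proof.
move=> h; elim/big_rec2: _ => [|i x m Pi hx]; first exact: deg_leC.
by apply: deg_leM => //; apply: h.
Qed.

Lemma deg_leXn n : deg_le n 'X^n.
Proof. by rewrite /deg_le size_polyXn. Qed.

Lemma deg_le_XsubC c : deg_le 1 ('X - c%:P).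
Proof. by rewrite /deg_le size_XsubC. Qed.

Lemma deg_le_compXn q n f : (0 < q)%N -> deg_le n f -> deg_le (n * q) (f \Po 'X^q).
Proof.
move=> q0 hf; have [->|f0] := eqVneq f 0; first by rewrite comp_poly0 /deg_le size_poly0.
rewrite /deg_le -[leqLHS]prednK ?size_poly_gt0 ?comp_poly_eq0 ?size_polyXn //.
rewrite ltnS size_comp_poly size_polyXn leq_mul2r.
by apply/orP; right; rewrite -ltnS (leq_trans _ hf) // prednK ?size_poly_gt0.
Qed.

End DegreeBounds.

Section CoefDegreeBounds.
Variable R : idomainType.

(** The inner variable is [x], so this bounds the [x]-degree; [deg_le] of the outer polynomial
    bounds the [t]-degree. *)
Definition coef_deg_le (n : nat) (f : {poly {poly R}}) : Prop :=
  forall i, deg_le n f`_i.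

Lemma coef_deg_leW m n f : (m <= n)%N -> coef_deg_le m f -> coef_deg_le n f.
Proof. by move=> mn hf i; apply: deg_leW (hf i). Qed.

Lemma coef_deg_leC n c : deg_le n c -> coef_deg_le n c%:P.
Proof. by move=> h i; rewrite coefC; case: ifP => // _; rewrite /deg_le size_poly0. Qed.

Lemma coef_deg_le1 : coef_deg_le 0 1.
Proof. by rewrite -polyC1; apply: coef_deg_leC; rewrite -polyC1; apply: deg_leC. Qed.

Lemma coef_deg_leD n f g : coef_deg_le n f -> coef_deg_le n g -> coef_deg_le n (f + g).
Proof. by move=> hf hg i; rewrite coefD; apply: deg_leD. Qed.

Lemma coef_deg_leN n f : coef_deg_le n f -> coef_deg_le n (- f).
Proof. by move=> hf i; rewrite coefN; apply: deg_leN. Qed.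

Lemma coef_deg_leM m n f g :
  coef_deg_le m f -> coef_deg_le n g -> coef_deg_le (m + n) (f * g).
Proof. by move=> hf hg i; rewrite coefM; apply: deg_le_sum => k _; apply: deg_leM. Qed.

Lemma coef_deg_leX n f k : coef_deg_le n f -> coef_deg_le (n * k) (f ^+ k).
Proof.
move=> hf; elim: k => [|k IH]; first by rewrite muln0 expr0; apply: coef_deg_le1.
by rewrite exprS mulnS; apply: coef_deg_leM.
Qed.

Lemma coef_deg_le_sum n I (r : seq I) (P : pred I) (f : I -> {poly {poly R}}) :
  (forall i, P i -> coef_deg_le n (f i)) -> coef_deg_le n (\sum_(i <- r | P i) f i).
Proof. by move=> h i; rewrite coef_sum; apply: deg_le_sum => j Pj; apply: h. Qed.

Lemma coef_deg_le_prod I (r : seq I) (P : pred I) (n : I -> nat) (f : I -> {poly {poly R}}) :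
  (forall i, P i -> coef_deg_le (n i) (f i)) ->
  coef_deg_le (\sum_(i <- r | P i) n i) (\prod_(i <- r | P i) f i).
Proof.
move=> h; elim/big_rec2: _ => [|i x m Pi hx]; first exact: coef_deg_le1.
by apply: coef_deg_leM => //; apply: h.
Qed.

Lemma coef_deg_le_XsubC n c : deg_le n c -> coef_deg_le n ('X - c%:P).
Proof.
move=> h; apply: coef_deg_leD; last by apply/coef_deg_leN/coef_deg_leC.
by move=> i; rewrite coefX /deg_le; case: eqP => _ /=; rewrite ?size_poly0 ?size_poly1.
Qed.

Lemma coef_deg_le_det n T (M : 'M[{poly {poly R}}]_n) :
  (forall i j, coef_deg_le T (M i j)) -> coef_deg_le (n * T) (\det M).
Proof.
move=> h; apply: coef_deg_le_sum => s _.
rewrite -[(n * T)%N]add0n; apply: coef_deg_leM.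
  by rewrite -signr_odd; case: odd; rewrite ?expr1 ?expr0;
    [apply: coef_deg_leN|]; apply: coef_deg_le1.
by rewrite -{1}[n]card_ord -sum_nat_const; apply: coef_deg_le_prod.
Qed.

Lemma coef_deg_le_twist Q n f : (0 < Q)%N -> coef_deg_le n f -> coef_deg_le (n * Q) (twist Q f).
Proof. by move=> Q0 h i; rewrite coef_map; apply: deg_le_compXn. Qed.

End CoefDegreeBounds.

(** Compare the orders of vanishing at [y]. *)
Lemma XsubC_exp_cancel (R : idomainType) (y : R) n1 n2 a b :
  ('X - y%:P) ^+ n1 * a = ('X - y%:P) ^+ n2 * b -> a.[y] != 0 -> b.[y] != 0 -> n1 = n2.
Proof.
wlog lt12 : n1 n2 a b / (n1 <= n2)%N => [hw e ha hb|].
  by case: (leqP n1 n2) => [|/ltnW] h; [apply: hw e ha hb|apply/esym/(hw _ _ _ _ h (esym e))].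
rewrite -(subnKC lt12) exprD -mulrA => /mulfI.
rewrite expf_eq0 polyXsubC_eq0 andbF => /(_ isT) -> + _.
case: (n2 - n1)%N => [|n]; first by rewrite addn0.
by rewrite hornerM horner_exp hornerXsubC subrr exprS !mul0r eqxx.
Qed.

(** * The auxiliary difference equation *)

Section TwoVariable.
Variables (F : finFieldType) (J I : finType) (k : J -> nat) (delta : J -> F).
Variables (Q D : nat) (nu : I -> J -> nat).
Hypotheses (Q_gt1 : (1 < Q)%N) (k_gt0 : forall j, (0 < k j)%N)
  (k_inj : forall j j' a b, (k j * Q ^ a = k j' * Q ^ b)%N -> j = j')
  (nu_le : forall a j, (nu a j <= D)%N).
Notation C := {poly F}.
Notation A := {poly {poly F}}.

Let Q_gt0 : (0 < Q)%N. Proof. exact: ltnW. Qed.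

(* The two variables are [x] (inner) and [t] (outer).  The zeros of [F_j] are the
   [zero_pt j m], [m >= N], and [zero_factor j m] is the numerator of its [m]-th
   factor over the common denominator [centre_prod]. *)
Definition zero_pt (j : J) (m : nat) : C := (delta j)%:P + 'X^(k j * Q ^ m).
Definition other_centres (j : J) : A := \prod_(c | c != delta j) ('X - c%:P%:P).
Definition centre_prod : A := \prod_(c : F) ('X - c%:P%:P).
Definition zero_factor (j : J) (m : nat) : A := ('X - (zero_pt j m)%:P) * other_centres j.
(** The tails satisfy [F_j = W / centre_prod * twist F_j] with [W = zero_factor j m]. With
    denominators cleared by means of [D], passing from [F ^ nu a] to its twist is multiplication by
    [twist_coef m a], up to the factor [twist_mult m] common to all [a]. *)
Definition twist_coef (m : nat) (a : I) : A :=
  \prod_j (centre_prod ^+ nu a j * zero_factor j m ^+ (D - nu a j)).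
Definition twist_mult (m : nat) : A := \prod_j (centre_prod ^+ D * zero_factor j m ^+ D).
(** The first [h] factors of [F ^ nu a], cleared by a denominator common to all [a]; this explains
    the exponent [D - nu a j]. *)
Definition trunc_monomial (m h : nat) (a : I) : A :=
  \prod_j ((\prod_(i < h) zero_factor j (m + i)) ^+ nu a j * (centre_prod ^+ h) ^+ (D - nu a j)).

Lemma centre_prodE j : centre_prod = ('X - (delta j)%:P%:P) * other_centres j.
Proof. by rewrite /centre_prod (bigD1 (delta j)). Qed.

Lemma twist_centre_prod : twist Q centre_prod = centre_prod.
Proof.
by rewrite /centre_prod rmorph_prod; apply: eq_bigr => c _; rewrite twist_XsubC comp_polyC.
Qed.

Lemma twist_other_centres j : twist Q (other_centres j) = other_centres j.
Proof.
by rewrite /other_centres rmorph_prod; apply: eq_bigr => c _; rewrite twist_XsubC comp_polyC.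
Qed.

Lemma comp_zero_pt j m : zero_pt j m \Po 'X^Q = zero_pt j m.+1.
Proof.
by rewrite /zero_pt comp_polyD comp_polyC comp_Xn_poly -exprM mulnC -mulnA -expnSr.
Qed.

Lemma twist_zero_factor j m : twist Q (zero_factor j m) = zero_factor j m.+1.
Proof. by rewrite /zero_factor rmorphM twist_XsubC twist_other_centres comp_zero_pt. Qed.

Lemma twist_twist_coef m a : twist Q (twist_coef m a) = twist_coef m.+1 a.
Proof.
rewrite /twist_coef rmorph_prod; apply: eq_bigr => j _.
by rewrite rmorphM !rmorphXn twist_centre_prod twist_zero_factor.
Qed.

Lemma iter_twist_coef r m a : iter r (twist Q) (twist_coef m a) = twist_coef (m + r) a.
Proof. by elim: r => [|r IH]; rewrite ?addn0 // iterS IH twist_twist_coef addnS. Qed.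

(** The twist shifts the indices [m, ..., m + h - 1] up by one, so only the factor of index [m] has
    to be traded. *)
Lemma twist_trunc_monomial m h a :
  twist_coef m a * trunc_monomial m h.+1 a = twist_mult m * twist Q (trunc_monomial m h a).
Proof.
rewrite /twist_coef /trunc_monomial /twist_mult rmorph_prod -!big_split; apply: eq_bigr => j _ /=.
rewrite big_ord_recl addn0 rmorphM !rmorphXn twist_centre_prod rmorph_prod.
under [X in _ = _ * (X ^+ _ * _)]eq_bigr => i _ do rewrite twist_zero_factor -addnS.
have e (x : A) : x ^+ D = x ^+ nu a j * x ^+ (D - nu a j) by rewrite -exprD subnKC.
move: (zero_factor j m) (\prod_(i < h) _) => W Z.
rewrite exprS !exprMn (e centre_prod) (e W).
set X1 := centre_prod ^+ nu a j; set X2 := W ^+ (D - _); set X3 := W ^+ nu a j.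
set X4 := Z ^+ _; set X5 := centre_prod ^+ (D - _); set X6 := _ ^+ (D - nu a j).
rewrite -!mulrA; congr (X1 * _).
rewrite (mulrCA X2) (mulrCA X5 X3) (mulrCA X4 X5) (mulrCA X2 X5) (mulrCA X5 X2).
by congr (_ * _); rewrite (mulrCA X5).
Qed.

(** As [kp] depends on neither [a] nor [h], summing over [a] turns a row of the Casorati matrix
    times the monomials into a multiple of a twist of the auxiliary form. *)
Lemma twisted_orbit_trunc_monomial m (P : I -> A) i : exists kp, forall h a,
  twisted_orbit (twist Q) (twist_coef m) P i a * trunc_monomial m (h + i) a
    = kp * iter i (twist Q) (P a * trunc_monomial m h a).
Proof.
elim: i => [|i [kp IH]]; first by exists 1 => h a; rewrite addn0 mul1r.
exists (twist_mult m * twist Q kp) => h a.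
rewrite [twisted_orbit _ _ _ _ _]/= addnS mulrAC twist_trunc_monomial -mulrA.
by rewrite [twist Q (trunc_monomial _ _ _) * _]mulrC -rmorphM IH rmorphM iterS mulrA.
Qed.

(** The [x]-degree [k j * Q ^ m] already determines [j] and [m]. *)
Lemma zero_pt_inj j j' m m' : zero_pt j m = zero_pt j' m' -> (j, m) = (j', m').
Proof.
move=> e; have kq (i : J) (n : nat) : (0 < k i * Q ^ n)%N.
  by rewrite muln_gt0 k_gt0 expn_gt0 Q_gt0.
have sz (i : J) (n : nat) : size (zero_pt i n) = (k i * Q ^ n).+1.
  rewrite /zero_pt addrC size_polyDl size_polyXn // ltnS.
  by apply: leq_trans (size_polyC_leq1 _) (kq i n).
have e2 : (k j * Q ^ m = k j' * Q ^ m')%N by apply/succn_inj; rewrite -!sz e.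
have ej := k_inj e2; rewrite -ej in e2 *; congr (_, _).
by move/eqP: e2; rewrite eqn_pmul2l // eqn_exp2l // => /eqP.
Qed.

Lemma zero_pt_neqC j m c : zero_pt j m - c%:P != 0.
Proof.
have kq : (0 < k j * Q ^ m)%N by rewrite muln_gt0 k_gt0 expn_gt0 Q_gt0.
rewrite /zero_pt addrAC -polyCB -size_poly_eq0 addrC size_polyDl size_polyXn // ltnS.
exact: leq_trans (size_polyC_leq1 _) kq.
Qed.

Lemma centre_prod_zero_pt_neq0 j m : centre_prod.[zero_pt j m] != 0.
Proof.
rewrite /centre_prod horner_prod; apply/prodf_neq0 => c _.
by rewrite hornerXsubC zero_pt_neqC.
Qed.

Lemma other_centres_zero_pt_neq0 j' j m : (other_centres j').[zero_pt j m] != 0.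
Proof.
rewrite /other_centres horner_prod; apply/prodf_neq0 => c _.
by rewrite hornerXsubC zero_pt_neqC.
Qed.

Lemma zero_factor_zero_pt_neq0 j' m' j m : (j', m') != (j, m) ->
  (zero_factor j' m').[zero_pt j m] != 0.
Proof.
move=> h; rewrite /zero_factor hornerM mulf_neq0 ?other_centres_zero_pt_neq0 // hornerXsubC subr_eq0.
by apply: contraNneq h => /zero_pt_inj ->.
Qed.

(** This makes [nu a j] readable from the order of vanishing at [zero_pt j m]. *)
Lemma twist_coef_zero_ptE m a j : exists G, twist_coef m a = ('X - (zero_pt j m)%:P) ^+ (D - nu a j) * G
  /\ G.[zero_pt j m] != 0.
Proof.
exists (centre_prod ^+ nu a j * other_centres j ^+ (D - nu a j) *
   \prod_(j' | j' != j) (centre_prod ^+ nu a j' * zero_factor j' m ^+ (D - nu a j'))); split.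
  by rewrite /twist_coef (bigD1 j) //= /zero_factor exprMn !mulrA [centre_prod ^+ _ * _]mulrC.
rewrite !hornerM !horner_exp !mulf_neq0 ?expf_neq0 ?centre_prod_zero_pt_neq0 ?other_centres_zero_pt_neq0 //.
rewrite horner_prod; apply/prodf_neq0 => j' nj.
rewrite hornerM !horner_exp mulf_neq0 ?expf_neq0 ?centre_prod_zero_pt_neq0 ?zero_factor_zero_pt_neq0 //.
by apply: contraNneq nj => -[->].
Qed.

Lemma twist_coef_zero_pt_neq0 m m' a j : m != m' -> (twist_coef m a).[zero_pt j m'] != 0.
Proof.
move=> nm; rewrite horner_prod; apply/prodf_neq0 => j' _.
rewrite hornerM !horner_exp mulf_neq0 ?expf_neq0 ?centre_prod_zero_pt_neq0 ?zero_factor_zero_pt_neq0 //.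
by apply: contraNneq nm => -[_ ->].
Qed.

(* The multiplicities of the roots [zero_pt j (m + i)] distinguish the [twist_coef _ a]:
   among many of them one is a root of none of [f], [g] and their twists. *)
Lemma twist_coef_inequiv m r a b (f g : A) : f != 0 -> g != 0 ->
  iter r (twist Q) (twist_coef m a) * twist Q f * g =
    iter r (twist Q) (twist_coef m b) * f * twist Q g ->
  nu a =1 nu b.
Proof.
rewrite !iter_twist_coef; move: (m + r)%N => {r}m f0 g0 e j.
have it0 i (x : A) : (iter i (twist Q) x == 0) = (x == 0).
  exact: iter_morph_eq0 (@twist_inj F Q Q_gt0) i x.
have e1 i : twist_coef (m + i) a * iter i.+1 (twist Q) f * iter i (twist Q) g
          = twist_coef (m + i) b * iter i (twist Q) f * iter i.+1 (twist Q) g.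
  rewrite -!iter_twist_coef !iterSr.
  by rewrite -!(iter_morphM (twist Q)) e.
(* In the product of the first [s] twists of [e] the twists of [f] and of [g] telescope. *)
have e2 s : (\prod_(i < s) twist_coef (m + i) a) * iter s (twist Q) f * g
   = (\prod_(i < s) twist_coef (m + i) b) * f * iter s (twist Q) g.
  elim: s => [|s IH]; first by rewrite !big_ord0 mul1r.
  rewrite !big_ord_recr /=.
  have h0 : iter s (twist Q) f * iter s (twist Q) g != 0 by rewrite mulf_neq0 ?it0.
  apply: (mulIf h0).
  transitivity ((\prod_(i < s) twist_coef (m + i) a * iter s (twist Q) f * g) *
     (twist_coef (m + s) a * iter s.+1 (twist Q) f * iter s (twist Q) g)).
    rewrite /=; set X1 := \prod_(i < s) _; set X2 := twist_coef _ _; set X3 := twist Q _.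
    set X4 := iter _ _ f; set X5 := iter _ _ g.
    ring.
  rewrite IH e1 /=.
  set X1 := \prod_(i < s) _; set X2 := twist_coef _ _; set X3 := twist Q _.
  set X4 := iter _ _ f; set X5 := iter _ _ g.
  ring.
(* Twisting keeps the [t]-degree, so the product [Phi] of [f], [g] and their [s]-th twists has size
   at most [s] and cannot vanish at [s] distinct points. *)
set s := ((size f + size g) + (size f + size g))%N.
have := e2 s; have := it0 s f; have := it0 s g.
have := size_iter_twist Q_gt0 s f; have := size_iter_twist Q_gt0 s g.
move: (iter s (twist Q) f) (iter s (twist Q) g) => sf sg szg szf.
rewrite (negbTE f0) (negbTE g0) => /negbT sg0 /negbT sf0 {}e2.
pose Phi := f * g * (sf * sg).
have Phi0 : Phi != 0 by rewrite !mulf_neq0.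
pose ys := [seq zero_pt j (m + i) | i <- iota 0 s].
have uys : uniq ys.
  by rewrite map_inj_uniq ?iota_uniq // => i1 i2 /zero_pt_inj [] /addnI.
have : ~~ all (root Phi) ys.
  apply/negP => h; have := max_poly_roots Phi0 h uys.
  rewrite ltnNge => /negP; apply; rewrite size_map size_iota.
  have szM (p1 p2 : A) : (size (p1 * p2)%R <= size p1 + size p2)%N.
    by apply: leq_trans (size_polyMleq _ _) (leq_pred _).
  apply: leq_trans (szM _ _) _; apply: leq_add; first exact: szM.
  by rewrite -szf -szg; apply: szM.
rewrite -has_predC => /hasP[z /mapP[i]]; rewrite mem_iota add0n => /andP[_ lis] {z}-> /=.
rewrite /Phi rootE !hornerM !mulf_eq0 !negb_or => /andP[/andP[fy gy] /andP[sfy sgy]].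
have prodE c : exists T, \prod_(i0 < s) twist_coef (m + i0) c = twist_coef (m + i) c * T
    /\ T.[zero_pt j (m + i)] != 0.
  exists (\prod_(i0 < s | i0 != Ordinal lis) twist_coef (m + i0) c); split.
    by rewrite (bigD1 (Ordinal lis)).
  rewrite horner_prod; apply/prodf_neq0 => i0 ni.
  rewrite twist_coef_zero_pt_neq0 //; apply: contraNneq ni => /addnI e0.
  by apply/eqP/val_inj.
have [T [eT T0]] := prodE a; have [T' [eT' T'0]] := prodE b.
have [G [eG Gy]] := twist_coef_zero_ptE (m + i) a j.
have [H [eH Hy]] := twist_coef_zero_ptE (m + i) b j.
move: e2; rewrite eT eT' eG eH -!mulrA => /XsubC_exp_cancel h.
have e3 : (D - nu a j = D - nu b j)%N.
  by apply: h; rewrite !hornerM !mulf_neq0.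
by rewrite -(subKn (nu_le a j)) e3 subKn.
Qed.

End TwoVariable.

(** * The truncated relation and the auxiliary form *)

Section Relation.
Variables (F : finFieldType) (J I : finType) (k : J -> nat) (delta : J -> F).
Variables (Q D : nat) (nu : I -> J -> nat) (c : I -> {poly F}).
Hypotheses (Q_gt1 : (1 < Q)%N) (k_gt1 : forall j, (1 < k j)%N)
  (nu_le : forall a j, (nu a j <= D)%N).
Notation C := {poly F}.
Notation A := {poly {poly F}}.
Notation zero_pt := (zero_pt k delta Q).
Notation zero_factor := (zero_factor k delta Q).
Notation trunc_monomial := (trunc_monomial k delta Q D nu).
Notation twist_coef := (twist_coef k delta Q D nu).
Notation KS := (\sum_j k j)%N.

Let k_gt0 j : (0 < k j)%N. Proof. exact: ltnW. Qed.
Let Q_gt0 : (0 < Q)%N. Proof. exact: ltnW. Qed.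

(* [c a] times the [s]-th truncation of [omega ^ nu a], without its denominator
   [prod_j (x - delta j) ^ (s D)]. *)
Definition relation_coef (s : nat) (a : I) : C :=
  c a * \prod_j ((\prod_(m < s) ('X - zero_pt j m)) ^+ nu a j
                 * (('X - (delta j)%:P) ^+ s) ^+ (D - nu a j)).

Lemma zero_pt_comp j m n : zero_pt j m \Po 'X^(Q ^ n) = zero_pt j (m + n).
Proof.
by rewrite /zero_pt comp_polyD comp_polyC comp_Xn_poly -exprM mulnC -mulnA -expnD.
Qed.

Lemma relation_coef_comp s n a : relation_coef s a \Po 'X^(Q ^ n) = (c a \Po 'X^(Q ^ n)) *
  \prod_j ((\prod_(m < s) ('X^(Q ^ n) - zero_pt j (m + n))) ^+ nu a j
           * (('X^(Q ^ n) - (delta j)%:P) ^+ s) ^+ (D - nu a j)).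
Proof.
rewrite /relation_coef rmorphM rmorph_prod /=; congr (_ * _); apply: eq_bigr => j _.
rewrite rmorphM !rmorphXn rmorph_prod /= comp_polyB comp_polyX comp_polyC.
by congr (_ ^+ _ * _); apply: eq_bigr => m _; rewrite comp_polyB comp_polyX zero_pt_comp.
Qed.

(** At [t = x^(Q^n)] the factors [s + n, ..., s + n + h - 1] of [F_j] become the factors
    [s, ..., s + h - 1] of [omega_j] with [x^(Q^n)] substituted for [x]. Multiplying by them
    lengthens the truncation from [s] to [s + h], up to a factor common to all [a]. *)
Lemma trunc_monomial_relation s n h a :
  (trunc_monomial (s + n) h a).['X^(Q ^ n)] * (relation_coef s a \Po 'X^(Q ^ n)) =
  (\prod_j (other_centres delta j).['X^(Q ^ n)] ^+ (h * D))
    * (relation_coef (s + h) a \Po 'X^(Q ^ n)).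
Proof.
rewrite !relation_coef_comp !(mulrCA _ (c a \Po _)); congr (_ * _).
rewrite /trunc_monomial horner_prod -!big_split; apply: eq_bigr => j _ /=.
rewrite hornerM !horner_exp horner_prod (centre_prodE delta j).
under eq_bigr => i _ do rewrite hornerM hornerXsubC.
rewrite big_split /= prodr_const card_ord hornerM hornerXsubC.
rewrite big_split_ord /=.
under [X in _ = _ * (( _ * X) ^+ _ * _)]eq_bigr => i _ do rewrite addnAC.
move: (\prod_(i < h) _) (\prod_(i < s) _) => X1 X2.
move: ('X^_ - _) (other_centres delta j).[_] => X3 X4.
have e : (X4 ^+ (h * D) = (X4 ^+ h) ^+ nu a j * (X4 ^+ h) ^+ (D - nu a j)).
  by rewrite exprM -exprD subnKC.
rewrite e exprD !exprMn.
move: (X1 ^+ nu a j) (X2 ^+ nu a j) ((X4 ^+ h) ^+ nu a j) (X3 ^+ h ^+ (D - nu a j))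
  (X4 ^+ h ^+ (D - nu a j)) (X3 ^+ s ^+ (D - nu a j)) => *; ring.
Qed.

Lemma deg_le_X_sub_zero_pt j m : deg_le (k j * Q ^ m) ('X - zero_pt j m).
Proof.
have kq : (0 < k j * Q ^ m)%N by rewrite muln_gt0 k_gt0 expn_gt0 Q_gt0.
apply: deg_leD; first by rewrite -['X]expr1; apply: deg_leW kq (deg_leXn _ _).
apply/deg_leN/deg_leD; last exact: deg_leXn.
by apply: deg_leW (deg_leC _).
Qed.

Lemma sum_expn_le n : (\sum_(m < n) Q ^ m <= Q ^ n)%N.
Proof.
elim: n => [|n IH]; first by rewrite big_ord0.
rewrite big_ord_recr /= expnS; apply: leq_trans (leq_mul Q_gt1 (leqnn _)).
by rewrite mul2n -addnn leq_add2r.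
Qed.

Lemma relation_coef_neq0 s a : c a != 0 -> relation_coef s a != 0.
Proof.
move=> c0; rewrite mulf_neq0 //; apply/prodf_neq0 => j _; rewrite mulf_neq0 ?expf_neq0 //.
  apply/prodf_neq0 => m _; rewrite subr_eq0; apply/eqP => e.
  (* An exponent above 1 keeps the term of degree [k j * Q ^ m] from cancelling against ['X]. *)
  have kq : (1 < k j * Q ^ m)%N.
    by apply: (leq_trans (k_gt1 j)); rewrite leq_pmulr // expn_gt0 Q_gt0.
  have := congr1 (fun p : C => p`_(k j * Q ^ m)%N) e.
  rewrite /zero_pt coefD coefC coefX coefXn eqxx !gtn_eqF ?(ltnW kq) //= add0r => /eqP.
  by rewrite eq_sym oner_eq0.
by rewrite polyXsubC_eq0.
Qed.

Lemma deg_relation_coef dc s a : deg_le dc (c a) ->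
  deg_le ((dc + D * KS) * Q ^ s) (relation_coef s a).
Proof.
move=> hc; rewrite mulnDl; apply: deg_leM.
  by apply: deg_leW hc; rewrite leq_pmulr // expn_gt0 Q_gt0.
rewrite -mulnA mulnC big_distrl /= big_distrl /=; apply: deg_le_prod => j _.
have -> : (k j * Q ^ s * D = k j * Q ^ s * nu a j + k j * Q ^ s * (D - nu a j))%N.
  by rewrite -mulnDr subnKC.
apply: deg_leM; apply: deg_leX.
  apply: (@deg_leW _ (\sum_(m < s) k j * Q ^ m)); last first.
    by apply: deg_le_prod => m _; apply: deg_le_X_sub_zero_pt.
  by rewrite -big_distrr /= leq_mul2l sum_expn_le orbT.
apply: (@deg_leW _ (1 * s)); last by apply: deg_leX; apply: deg_le_XsubC.
rewrite leq_mul //; apply: ltnW; exact: ltn_expl.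
Qed.

Lemma deg_relation_coef_comp dc s n a : deg_le dc (c a) ->
  deg_le ((dc + D * KS) * Q ^ (s + n)) (relation_coef s a \Po 'X^(Q ^ n)).
Proof.
by move=> hc; rewrite expnD mulnA; apply: deg_le_compXn; rewrite ?expn_gt0 ?Q_gt0 ?deg_relation_coef.
Qed.

Definition aux_form (P : I -> A) (m h : nat) : A := \sum_a P a * trunc_monomial m h a.

(** The values of [P] at [x^(Q^n)] are proportional to the terms of the relation truncated at [s],
    so the form takes there a multiple of the relation truncated at [s + h]. Multiplying by the term
    of [a0] avoids a division. *)
Lemma aux_form_eval (P : I -> A) s n h a0 :
  (forall a, (P a).['X^(Q ^ n)] * (relation_coef s a0 \Po 'X^(Q ^ n))
           = (P a0).['X^(Q ^ n)] * (relation_coef s a \Po 'X^(Q ^ n))) ->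
  (aux_form P (s + n) h).['X^(Q ^ n)] * (relation_coef s a0 \Po 'X^(Q ^ n)) =
  (P a0).['X^(Q ^ n)] * (\prod_j (other_centres delta j).['X^(Q ^ n)] ^+ (h * D))
   * ((\sum_a relation_coef (s + h) a) \Po 'X^(Q ^ n)).
Proof.
move=> hP; rewrite /aux_form horner_sum rmorph_sum mulr_suml mulr_sumr; apply: eq_bigr => a _ /=.
by rewrite hornerM mulrAC hP -mulrA [_ * (trunc_monomial _ _ _).[_]]mulrC mulrCA trunc_monomial_relation.
Qed.

Lemma deg_centre_prod : deg_le #|F| (centre_prod F).
Proof. by rewrite /centre_prod -sum1_card; apply: deg_le_prod => i _; apply: deg_le_XsubC. Qed.

Lemma deg_zero_factor j m : deg_le #|F| (zero_factor j m).
Proof.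
rewrite /zero_factor -sum1_card (bigD1 (delta j)) //=; apply: deg_leM; first exact: deg_le_XsubC.
by apply: deg_le_prod => i _; apply: deg_le_XsubC.
Qed.

Lemma deg_trunc_monomial m h a : deg_le (#|F| * (h * (D * #|J|))) (trunc_monomial m h a).
Proof.
rewrite mulnA (mulnC D) mulnCA -sum_nat_const; apply: deg_le_prod => j _.
rewrite -{1}(subnKC (nu_le a j)) mulnDr; apply: deg_leM; apply: deg_leX.
  rewrite -{1}[h]card_ord mulnC -sum_nat_const; apply: deg_le_prod => i _; exact: deg_zero_factor.
by apply: deg_leX; apply: deg_centre_prod.
Qed.

Lemma coef_deg_twist_coef m a : coef_deg_le (D * KS * Q ^ m) (twist_coef m a).
Proof.
rewrite mulnAC mulnC big_distrl /=; apply: coef_deg_le_prod => j _.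
have cv (B : pred F) : coef_deg_le 0 (\prod_(e | B e) ('X - e%:P%:P) : A).
  have -> : 0%N = (\sum_(e | B e) 0)%N by rewrite big1.
  apply: coef_deg_le_prod => e _.
  by apply: coef_deg_le_XsubC; apply: deg_leC.
rewrite -[X in coef_deg_le X]add0n; apply: coef_deg_leM.
  by rewrite -[0%N](mul0n (nu a j)); apply: coef_deg_leX; apply: cv.
apply: (@coef_deg_leW _ (k j * Q ^ m * (D - nu a j))).
  by rewrite -mulnA leq_mul2l (mulnC D) leq_mul2l leq_subr !orbT.
apply: coef_deg_leX; rewrite -[(k j * _)%N]addn0; apply: coef_deg_leM (cv _).
apply: coef_deg_le_XsubC; apply: deg_leD; last exact: deg_leXn.
by apply: deg_leW (deg_leC _).
Qed.

(** Each step multiplies the degree by [Q] through the twist and adds [D * KS * Q ^ m]; the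
    recursion for the coefficient of [Q ^ m] does not involve [m]. *)
Lemma coef_deg_twisted_orbit m b (P : I -> A) i a : coef_deg_le (b * Q ^ m) (P a) ->
  coef_deg_le (iter i (fun u => u * Q + D * KS)%N b * Q ^ m)
    (twisted_orbit (twist Q) (twist_coef m) P i a).
Proof.
move=> hP; elim: i => //= i IH; rewrite mulnDl mulnAC addnC; apply: coef_deg_leM.
  exact: coef_deg_twist_coef.
by apply: coef_deg_le_twist.
Qed.

End Relation.

(** * Linear algebra: auxiliary polynomials *)

Lemma linear_system_solution (F : fieldType) (U E : finType) (M : E -> U -> F) :
  (#|E| < #|U|)%N ->
  exists2 u : U -> F, (exists t, u t != 0) & forall s, \sum_t u t * M s t = 0.
Proof.
move=> cEU; pose A := \matrix_(i < #|U|, j < #|E|) M (enum_val j) (enum_val i).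
have : kermx A != 0.
  rewrite -mxrank_eq0 mxrank_ker -lt0n subn_gt0.
  by apply: leq_ltn_trans cEU; apply: rank_leq_col.
case/rowV0Pn => v; rewrite (sameP sub_kermxP eqP) => /eqP vA v0.
exists (fun t => v 0 (enum_rank t)).
  case/rV0Pn: v0 => i vi; exists (enum_val i); by rewrite enum_valK.
move=> s; move/rowP/(_ (enum_rank s)): vA; rewrite !mxE => e; apply: etrans e.
rewrite (reindex (@enum_rank U)) /=; last first.
  by apply: onW_bij; apply: (Bijective (@enum_rankK U) (@enum_valK U)).
by apply: eq_bigr => t _; rewrite !mxE !enum_rankK.
Qed.

(** A count of unknowns, the [L.+1 * A * B] coefficients of the [P a], against equations.
    Proportionality to the vector [r n] is tested on the minors involving [ord0], which are linear
    in [P] and have size at most [A * Q ^ n + B + T]. *)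
Lemma auxiliary_polynomials (F : fieldType) (Q L N A B T : nat)
    (r : nat -> 'I_L.+1 -> {poly F}) :
  (forall n a, (n < N)%N -> deg_le T (r n a)) ->
  (L * (\sum_(n < N) (A * Q ^ n + B + T)) < L.+1 * A * B)%N ->
  exists P : 'I_L.+1 -> {poly {poly F}}, [/\ exists a, P a != 0,
    forall a, (size (P a) <= A)%N, forall a, coef_deg_le B (P a) &
    forall n a, (n < N)%N ->
      (P a).['X^(Q ^ n)] * r n ord0 = (P ord0).['X^(Q ^ n)] * r n a].
Proof.
move=> hr hcount.
pose U := ('I_L.+1 * 'I_A * 'I_B)%type.
pose E := {n : 'I_N & ('I_L * 'I_(A * Q ^ n + B + T))%type}.
(* A basis of the admissible families: one monomial in one component. *)
pose e (t : U) (a : 'I_L.+1) : {poly {poly F}} :=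
  if a == t.1.1 then ('X^(t.2))%:P * 'X^(t.1.2) else 0.
pose phi (n : nat) (a : 'I_L.+1) (P : 'I_L.+1 -> {poly {poly F}}) : {poly F} :=
  (P a).['X^(Q ^ n)] * r n ord0 - (P ord0).['X^(Q ^ n)] * r n a.
pose M (s : E) (t : U) : F :=
  (phi (tag s) (lift ord0 (tagged s).1) (e t))`_((tagged s).2).
have cEU : (#|{: E}| < #|{: U}|)%N.
  rewrite card_tagged sumnE big_map big_enum /= !card_prod !card_ord.
  under eq_bigr => n _ do rewrite card_prod !card_ord.
  by rewrite -big_distrr.
have [u [t0 ut0] hu] := linear_system_solution M cEU.
pose P a : {poly {poly F}} := \sum_t (u t)%:P%:P * e t a.
have phiP n a : phi n a P = \sum_t (u t)%:P * phi n a (e t).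
  rewrite /phi /P !horner_sum !mulr_suml -sumrB; apply: eq_bigr => t _.
  by rewrite !hornerM !hornerC mulrBr !mulrA.
have sP a : (size (P a) <= A)%N.
  apply: leq_trans (size_sum _ _ _) _; apply/bigmax_leqP => t _.
  rewrite /e; case: ifP => _; last by rewrite mulr0 size_poly0.
  rewrite mulrA -polyCM; apply: leq_trans (size_polyMleq _ _) _.
  rewrite size_polyXn addnS /=.
  by apply: leq_trans (leq_add (size_polyC_leq1 _) (leqnn _)) _; rewrite add1n.
have cP a i : (size ((P a)`_i)%R <= B)%N.
  rewrite coef_sum; apply: leq_trans (size_sum _ _ _) _; apply/bigmax_leqP => t _.
  rewrite coefCM /e; case: ifP => _; last by rewrite coef0 mulr0 size_poly0.
  rewrite coefCM coefXn; case: eqP => _; last by rewrite !mulr0 size_poly0.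
  rewrite mulr1; apply: leq_trans (size_polyMleq _ _) _.
  rewrite size_polyXn addnS /=.
  by apply: leq_trans (leq_add (size_polyC_leq1 _) (leqnn _)) _; rewrite add1n.
exists P; split => //.
- exists t0.1.1; apply/eqP => /(congr1 (fun p : {poly {poly F}} => p`_(t0.1.2)`_(t0.2))).
  rewrite coef_sum coef_sum (bigD1 t0) //= big1 ?addr0 => [|t ht].
    rewrite /e eqxx !coefCM coefXn eqxx mulr1 coefXn eqxx mulr1 !coef0 => /eqP.
    by rewrite (negbTE ut0).
  rewrite /e; case: eqP => [ea|_]; last by rewrite mulr0 !coef0.
  rewrite !coefCM coefXn; case: eqP => [ei|_]; last by rewrite !mulr0 ?coef0 ?mulr0.
  rewrite mulr1 coefXn; case: eqP => [eb|_]; last by rewrite mulr0.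
  case/eqP: ht; case: t t0 {ut0} ea ei eb => [[a i] b] [[a0 i0] b0] /= -> ei eb.
  by congr (_, _, _); apply: val_inj.
- by move=> a i; apply: leq_trans (cP a i) _.
move=> n a nN; apply/eqP; rewrite -subr_eq0; apply/eqP.
have [->|a0] := eqVneq a ord0; first by rewrite subrr.
change (phi n a P = 0); apply/polyP => s; rewrite coef0.
have [hs|hs] := ltnP s (A * Q ^ n + B + T); last first.
  apply: nth_default; apply: leq_trans hs.
  have szE b : (size ((P b).['X^(Q ^ n)])%R <= A * Q ^ n + B)%N.
    rewrite horner_coef; apply: leq_trans (size_sum _ _ _) _; apply/bigmax_leqP => i _.
    apply: leq_trans (size_polyMleq _ _) _; rewrite -exprM size_polyXn addnS /= addnC.
    apply: leq_add (cP _ _); rewrite mulnC leq_mul2r.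
    by rewrite (leq_trans (ltnW (ltn_ord i)) (sP b)) orbT.
  have szM b c : (size ((P b).['X^(Q ^ n)] * r n c)%R <= A * Q ^ n + B + T)%N.
    apply: leq_trans (size_polyMleq _ _) _.
    have := leq_add (szE b) (hr n c nN); rewrite addnS.
    by case: (_ + _)%N.
  apply: leq_trans (size_polyD _ _) _; rewrite size_polyN geq_max; apply/andP; split; exact: szM.
have [a' ea] : exists a', a = lift ord0 a'.
  by case: (unliftP ord0 a) a0 => [a' ->|->]; [exists a'|rewrite eqxx].
have := hu (Tagged (fun n : 'I_N => 'I_L * 'I_(A * Q ^ n + B + T))%type
  (i := Ordinal nN) (a', Ordinal hs)).
rewrite /M /= -ea phiP coef_sum => e0; apply: etrans e0.
by apply: eq_bigr => t _; rewrite coefCM.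
Qed.

(** * Smallness of the auxiliary functions *)

Section Evaluation.
Variables (R : realType) (K : fieldType) (N : K -> R) (absN : nonarch_abs N).
Variables (F : finFieldType) (emb : {rmorphism F -> K}) (x : K) (Q : nat).
Hypotheses (x_neq0 : x != 0) (x_lt1 : N x < 1) (Q_gt1 : (1 < Q)%N)
  (frobK : forall a b : K, (a + b) ^+ Q = a ^+ Q + b ^+ Q)
  (frobF : forall a : F, a ^+ Q = a).
Notation C := {poly F}.
Notation A := {poly {poly F}}.

Definition ev : {rmorphism C -> K} := (horner_eval x \o map_poly emb).
Definition evp : {rmorphism A -> {poly K}} := map_poly ev.

Let Nx_gt0 : 0 < N x. Proof. by rewrite (abs_gt0 absN). Qed.
Let Nx_ge0 : 0 <= N x. Proof. exact: ltW. Qed.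
Let Nx_le1 : N x <= 1. Proof. exact: ltW. Qed.
Let Q_gt0 : (0 < Q)%N. Proof. exact: ltnW. Qed.

Lemma evX : ev 'X = x.
Proof. by rewrite /= map_polyX /horner_eval hornerX. Qed.

Lemma evC a : ev a%:P = emb a.
Proof. by rewrite /= map_polyC /horner_eval hornerC. Qed.

(** Nonzero elements of a finite field are roots of unity. *)
Lemma abs_emb a : a != 0 -> N (emb a) = 1.
Proof.
move=> a0; apply: (abs_root1 absN (n := #|F|.-1)).
  by rewrite -ltnS prednK ?card_finNzRing_gt1 // ltnW // card_finNzRing_gt1.
rewrite -rmorphXn; apply/eqP; rewrite fmorph_eq1.
by rewrite -(inj_eq (mulfI a0)) -exprS prednK ?expf_card ?mulr1 // ltnW // card_finNzRing_gt1.
Qed.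

Lemma abs_emb_le1 a : N (emb a) <= 1.
Proof.
by have [->|/abs_emb->] := eqVneq a 0; rewrite ?rmorph0 ?(abs0 absN).
Qed.

Lemma abs_expx m n : (m <= n)%N -> N x ^+ n <= N x ^+ m.
Proof. by move=> mn; apply: ler_wiXn2l. Qed.

Lemma abs_ev_le1 f : N (ev f) <= 1.
Proof.
elim/poly_ind: f => [|f a IH]; first by rewrite rmorph0 (abs0 absN).
rewrite rmorphD rmorphM evX evC; apply: (absD_le absN); rewrite ?abs_emb_le1 //.
by rewrite (absM absN) mulr_ile1 ?(abs_ge0 absN).
Qed.

(** A Liouville inequality: nonzero coefficients have absolute value 1, so the value has the size of
    [x] to the power of the order of [f] at 0, which is at most [T]. *)
Lemma abs_ev_ge T f : f != 0 -> deg_le T f -> N x ^+ T <= N (ev f).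
Proof.
elim/poly_ind: f T => [|f a IH] T; first by rewrite eqxx.
have [->|a0 _ _] := eqVneq a 0; last first.
  rewrite rmorphD rmorphM evX evC addrC (abs_addl absN).
    by rewrite abs_emb // exprn_ile1.
  rewrite abs_emb // (absM absN); apply: le_lt_trans x_lt1.
  by rewrite ler_piMl ?abs_ev_le1.
rewrite addr0 => f0; have {f0}f0 : f != 0 by apply: contraNneq f0 => ->; rewrite mul0r.
rewrite /deg_le size_mulX // => hT.
case: T hT => [|T]; first by rewrite ltnS leqn0 size_poly_eq0 (negbTE f0).
rewrite ltnS => hT; rewrite rmorphM evX (absM absN) exprSr.
by rewrite ler_pM2r // IH.
Qed.

(** [Q]-th powers are additive on [K] and fix the coefficients, so substituting [x^Q] raises values
    to the power [Q]. *)
Lemma ev_comp f n : ev (f \Po 'X^(Q ^ n)) = ev f ^+ (Q ^ n).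
Proof.
elim: n f => [|n IH] f; first by rewrite expn0 !expr1 comp_polyXr.
rewrite expnSr exprM -comp_Xn_poly comp_polyA IH mulnC exprM; congr (_ ^+ _).
elim/poly_ind: f {IH} => [|f a IH]; first by rewrite comp_poly0 !rmorph0 expr0n gtn_eqF.
rewrite comp_polyD comp_polyM comp_polyX comp_polyC !rmorphD !rmorphM IH.
by rewrite frobK exprMn rmorphXn evX evC -[emb a ^+ Q]rmorphXn frobF.
Qed.

Lemma evp_le1 f : disc_le N 0 1 1 (evp f).
Proof. by apply/disc_le01 => k; rewrite coef_map; apply: abs_ev_le1. Qed.

Lemma twist_le C0 f : disc_le N 0 1 C0 (evp f) -> disc_le N 0 1 C0 (evp (twist Q f)).
Proof.
move=> /disc_le01 h; apply/disc_le01 => k; apply: le_trans (h k).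
have -> : (evp (twist Q f))`_k = ev f`_k ^+ Q.
  by have h1 := ev_comp f`_k 1; rewrite expn1 in h1; rewrite coef_map coef_map; apply: h1.
rewrite coef_map (absX absN) -[X in _ ^+ X]prednK // exprS.
by rewrite ler_piMr ?(abs_ge0 absN) // exprn_ile1 ?(abs_ge0 absN) ?abs_ev_le1.
Qed.

Lemma iter_twist_le C0 f i :
  disc_le N 0 1 C0 (evp f) -> disc_le N 0 1 C0 (evp (iter i (twist Q) f)).
Proof. by move=> h; elim: i => //= i; apply: twist_le. Qed.

Lemma evp_C y : evp y%:P = (ev y)%:P.
Proof. by rewrite /= map_polyC. Qed.

Lemma evp_XsubC y : evp ('X - y%:P) = 'X - (ev y)%:P.
Proof. by rewrite /= rmorphB /= map_polyX map_polyC. Qed.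

(* Holds for products of linear factors with roots in the closed unit disc. *)
Definition cancellable (f : A) := forall C0 g,
  disc_le N 0 1 C0 (evp f * g) -> disc_le N 0 1 C0 g.

Lemma cancellableM f g : cancellable f -> cancellable g -> cancellable (f * g).
Proof. by move=> hf hg C0 h; rewrite rmorphM -mulrA => /hf/hg. Qed.

Lemma cancellable1 : cancellable 1.
Proof. by move=> C0 h; rewrite rmorph1 mul1r. Qed.

Lemma cancellable_prod I (r : seq I) (P : pred I) (f : I -> A) :
  (forall i, P i -> cancellable (f i)) -> cancellable (\prod_(i <- r | P i) f i).
Proof. by move=> h; apply: big_ind => //; [apply: cancellable1|apply: cancellableM]. Qed.

Lemma cancellableX f n : cancellable f -> cancellable (f ^+ n).
Proof.
move=> h; elim: n => [|n IH]; first exact: cancellable1.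
by rewrite exprS; apply: cancellableM.
Qed.

Lemma cancellable_XsubC y : cancellable ('X - y%:P).
Proof.
move=> C0 h; rewrite evp_XsubC => /(disc_le_divr absN ltr01); rewrite divr1; apply.
by rewrite add0r (absNE absN) abs_ev_le1.
Qed.

Variables (J I : finType) (k : J -> nat) (delta : J -> F).
Variables (D : nat) (nu : I -> J -> nat).
Hypotheses (k_gt1 : forall j, (1 < k j)%N) (nu_le : forall a j, (nu a j <= D)%N).
Notation centre_prod := (centre_prod F).
Notation zero_pt := (zero_pt k delta Q).
Notation zero_factor := (zero_factor k delta Q).
Notation trunc_monomial := (trunc_monomial k delta Q D nu).

Lemma cancellable_centre_prod : cancellable centre_prod.
Proof. by apply: cancellable_prod => c _; apply: cancellable_XsubC. Qed.

Lemma cancellable_zero_factor j m : cancellable (zero_factor j m).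
Proof.
apply: cancellableM; first exact: cancellable_XsubC.
by apply: cancellable_prod => c _; apply: cancellable_XsubC.
Qed.

Lemma cancellable_trunc_monomial m h a : cancellable (trunc_monomial m h a).
Proof.
apply: cancellable_prod => j _; apply: cancellableM; apply: cancellableX.
  by apply: cancellable_prod => i _; apply: cancellable_zero_factor.
by apply: cancellableX; apply: cancellable_centre_prod.
Qed.

Definition centres : seq K := [seq emb c | c <- enum F].

Lemma size_centres : size centres = #|F|.
Proof. by rewrite size_map -cardE. Qed.

Lemma centres_uniq : uniq centres.
Proof. by rewrite map_inj_uniq ?enum_uniq //; apply: fmorph_inj. Qed.

Lemma centres_le1 : {in centres, forall c, N c <= 1}.
Proof. by move=> _ /mapP[c _ ->]; apply: abs_emb_le1. Qed.

Lemma centres_dist : {in centres &, forall c c', c != c' -> N (c - c') = 1}.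
Proof.
move=> _ _ /mapP[c _ ->] /mapP[c' _ ->] h; rewrite -rmorphB abs_emb //.
by rewrite subr_eq0; apply: contraNneq h => ->.
Qed.

(** * Discs of radius [N x ^+ (Q ^ m)] about the finite field *)

Section Level.
Variable m : nat.
Notation rho := (N x ^+ (Q ^ m)).

Let rho_gt0 : 0 < rho. Proof. exact: exprn_gt0. Qed.
Let rho_le1 : rho <= 1. Proof. exact: exprn_ile1. Qed.

Lemma disc_le_evp c f : c \in centres -> disc_le N c rho 1 (evp f).
Proof.
by move=> cc; apply: (disc_le_unit absN) => //; [apply: centres_le1|apply: evp_le1].
Qed.

Lemma disc_centre_prod c : c \in centres -> disc_le N c rho rho (evp centre_prod).
Proof.
move=> cc; case/mapP: (cc) => b _ eb.
rewrite /centre_prod (bigD1 b) //= rmorphM -[X in disc_le _ _ _ X]mulr1.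
apply: (disc_leM absN) => //; last exact: disc_le_evp.
rewrite evp_XsubC evC -eb; apply: (disc_le_XsubC absN) => //.
by rewrite subrr (abs0 absN) ltW.
Qed.

(** [zero_factor j n] differs from [centre_prod] by a multiple of [x^(k j * Q ^ n)], which is within
    the radius once [m <= n]. *)
Lemma disc_zero_factor c j n : (m <= n)%N -> c \in centres ->
  disc_le N c rho rho (evp (zero_factor j n)).
Proof.
move=> mn cc.
have -> : zero_factor j n = centre_prod - ('X^(k j * Q ^ n))%:P * other_centres delta j.
  by rewrite /zero_factor (centre_prodE delta j) /zero_pt polyCD opprD addrA mulrBl.
rewrite rmorphB rmorphM; apply: (disc_leB absN) => //; first exact: disc_centre_prod.
rewrite -[X in disc_le _ _ _ X]mulr1; apply: (disc_leM absN) => //; last exact: disc_le_evp.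
rewrite evp_C; apply: (disc_leC absN) => //.
rewrite rmorphXn evX (absX absN) abs_expx //.
rewrite (leq_trans (leq_pexp2l Q_gt0 mn)) // leq_pmull //; exact: ltnW.
Qed.

Lemma disc_trunc_monomial c h a : c \in centres ->
  disc_le N c rho (rho ^+ (h * (D * #|J|))) (evp (trunc_monomial m h a)).
Proof.
move=> cc; rewrite rmorph_prod.
have -> : rho ^+ (h * (D * #|J|)) = \prod_(j : J) rho ^+ (h * D).
  by rewrite prodr_const mulnA exprM.
apply: (disc_le_prod absN) => // j _.
rewrite -{1}(subnKC (nu_le a j)) mulnDr exprD rmorphM !rmorphXn rmorph_prod.
apply: (disc_leM absN) => //; rewrite exprM; apply: (disc_leX absN) => //; last first.
  by apply: (disc_leX absN) => //; apply: disc_centre_prod.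
rewrite -{1}[h]card_ord -prodr_const; apply: (disc_le_prod absN) => // i _.
by apply: disc_zero_factor => //; apply: leq_addr.
Qed.

Lemma disc_aux_form P h c : c \in centres ->
  disc_le N c rho (rho ^+ (h * (D * #|J|))) (evp (aux_form k delta Q D nu P m h)).
Proof.
move=> cc; rewrite rmorph_sum; apply: (disc_le_sum absN) => //.
  by rewrite exprn_ge0 // ltW.
move=> a _; rewrite rmorphM -[X in disc_le _ _ _ X]mul1r.
by apply: (disc_leM absN) => //; [apply: disc_le_evp|apply: disc_trunc_monomial].
Qed.

Definition points : seq K := [seq x ^+ (Q ^ n) | n <- iota 0 m].

Lemma points_abs_ge t : t \in points -> rho <= N t.
Proof.
case/mapP=> n; rewrite mem_iota add0n => /andP[_ nm] ->.
by rewrite (absX absN) abs_expx // leq_exp2l // ltnW.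
Qed.

Lemma points_le1 : {in points, forall t, N t <= 1}.
Proof. by move=> _ /mapP[n _ ->]; rewrite (absX absN) exprn_ile1. Qed.

Lemma points_dist_lt n n' : (n < n' < m)%N -> rho <= N (x ^+ (Q ^ n) - x ^+ (Q ^ n')).
Proof.
case/andP=> nn' nm; rewrite (abs_addl absN) ?(absNE absN) !(absX absN).
  by rewrite abs_expx // leq_exp2l // ltnW // (ltn_trans nn').
by rewrite ltr_iXn2l // ltn_exp2l.
Qed.

Lemma points_dist : {in points &, forall t t', t != t' -> rho <= N (t - t')}.
Proof.
move=> _ _ /mapP[n + ->] /mapP[n' + ->]; rewrite !mem_iota !add0n => /andP[_ nm] /andP[_ nm'].
case: (ltngtP n n') => [h|h|->] ne; last by rewrite eqxx in ne.
  by apply: points_dist_lt; rewrite h.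
by rewrite (absB absN); apply: points_dist_lt; rewrite h.
Qed.

Lemma points_uniq : uniq points.
Proof.
rewrite map_inj_in_uniq ?iota_uniq // => n n' _ _ e.
have {e} : N x ^+ (Q ^ n) = N x ^+ (Q ^ n') by rewrite -!(absX absN) e.
case: (ltngtP n n') => // h e.
  suff : N x ^+ (Q ^ n') < N x ^+ (Q ^ n) by rewrite e ltxx.
  by rewrite ltr_iXn2l // ltn_exp2l.
suff : N x ^+ (Q ^ n) < N x ^+ (Q ^ n') by rewrite e ltxx.
by rewrite ltr_iXn2l // ltn_exp2l.
Qed.

Lemma centre_point_dist c t : c \in centres -> t \in points -> N t <= N (c - t).
Proof.
case/mapP=> b _ -> /mapP[n _ ->]; have [->|b0] := eqVneq b 0.
  by rewrite rmorph0 add0r (absNE absN).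
have lt1 : N (x ^+ (Q ^ n)) < 1 by rewrite (absX absN) exprn_ilt1 // gtn_eqF // expn_gt0 Q_gt0.
rewrite (abs_addl absN) ?(absNE absN) abs_emb //; exact: ltW.
Qed.

(** The worst centre is 0, where the exponents [Q ^ n], [n < m], add up to at most [Q ^ m]; from any
    other centre all points have distance 1. *)
Lemma centre_points_prod c : c \in centres -> rho <= \prod_(t <- points) N (c - t).
Proof.
move=> cc; apply: (@le_trans _ _ (\prod_(t <- points) N t)); last first.
  rewrite !big_seq; apply: ler_prod => t tp.
  by rewrite (abs_ge0 absN) centre_point_dist.
rewrite /points big_map.
under eq_bigr => n _ do rewrite (absX absN).
rewrite -expr_sum abs_expx // -{1}[m]subn0 -/(index_iota 0 m).
by rewrite big_mkord sum_expn_le.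
Qed.

Lemma size_evp f : (size (evp f) <= size f)%N.
Proof. by rewrite /= map_polyE (leq_trans (size_Poly _)) // size_map. Qed.

(** The Schwarz lemma with [eta], [kappa] and the radius all equal to [rho]. Put
    [W = h * (D * #|J|)]: on the discs the form is at most [rho ^+ W], its size is at most
    [#|F| * (A0 + W)], and the [m] points leave [W - g.+1] blocks, whence the bound [rho ^+ g]. *)
Lemma aux_form_small (P : I -> A) (h A0 g c1 : nat) : m = (#|F| * (A0 + g.+1))%N ->
  (forall a, size (P a) <= #|F| * A0)%N -> (0 < #|F| * A0)%N ->
  (forall n, (n < m)%N -> N (ev (aux_form k delta Q D nu P m h).['X^(Q ^ n)]) * N x ^+ (c1 * Q ^ m)
       <= N x ^+ (Q ^ (m + h))) ->
  (c1 + m + h * (D * #|J|) <= Q ^ h)%N -> (g < h * (D * #|J|))%N ->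
  disc_le N 0 1 (rho ^+ g) (evp (aux_form k delta Q D nu P m h)).
Proof.
move=> em sP A00 hG hQ hg.
set G := aux_form _ _ _ _ _ _ _ _ in hG *; set W := (h * (D * #|J|))%N in hQ hg.
have eW : (W = 1 + (W - g.+1) + g)%N by lia.
have -> : rho ^+ g = rho ^+ W / (rho * rho ^+ (W - g.+1)).
  by rewrite {1}eW !exprD expr1 mulrAC mulfV ?mul1r // mulf_neq0 // gt_eqF // exprn_gt0.
(* The values at the points have to stay below [rho ^+ W] even after the division by [rho ^+ m] in
   the interpolation. *)
have hQm : (c1 * Q ^ m + Q ^ m * (W + m) <= Q ^ (m + h))%N.
  by rewrite mulnC -mulnDr expnD leq_mul2l; apply/orP; right; lia.
apply: (@disc_le_schwarz _ _ N absN centres rho _ _ centres_uniq centres_le1 centres_dist points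
  (A0 + g.+1) (W - g.+1) rho rho (rho ^+ W) (N x ^+ (Q ^ (m + h) - c1 * Q ^ m))) => //.
- by rewrite size_map size_iota size_centres.
- exact: points_uniq.
- exact: exprn_ge0.
- exact: points_le1.
- exact: points_dist.
- by move=> c t cc tp; apply: le_trans (centre_point_dist cc tp); apply: points_abs_ge.
- exact: centre_points_prod.
- move=> _ /mapP[n + ->]; rewrite mem_iota add0n => /andP[_ nm].
  have := hG n nm; have -> : ev G.['X^(Q ^ n)] = (evp G).[x ^+ (Q ^ n)].
    by rewrite -horner_map rmorphXn evX.
  rewrite -[X in _ <= N x ^+ X](@subnK (c1 * Q ^ m)); last by lia.
  by rewrite exprD ler_pM2r // exprn_gt0.
- rewrite size_map size_iota ler_pdivrMr ?exprn_gt0 // -exprD -exprM abs_expx //; lia.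
- by move=> c cc; apply: disc_aux_form.
- apply: leq_trans (size_evp _) _; rewrite size_centres.
  apply: leq_trans (size_sum _ _ _) _; apply/bigmax_leqP => a _.
  apply: leq_trans (size_polyMleq _ _) _.
  have := deg_trunc_monomial k delta Q nu_le m h a; rewrite /deg_le -/W => hs.
  have -> : (A0 + g.+1 + (W - g.+1) = A0 + W)%N by lia.
  rewrite mulnDr; have := leq_add (sP a) hs; rewrite addnS.
  by case: (_ + _)%N.
- by rewrite mulr_ile1 ?exprn_ge0 ?exprn_ile1 // ltW.
Qed.

End Level.
End Evaluation.

(** * Independence of the elementary products *)

Lemma affine_le_expn (Q a b : nat) : (1 < Q)%N ->
  exists h0, forall h, (h0 <= h)%N -> (a + h * b <= Q ^ h)%N.
Proof.
move=> Q1; have [t et] : exists t, t = (a + b).+1 by exists (a + b).+1.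
exists (3 * t)%N => h.
have ht n : (n < Q ^ n)%N by apply: ltn_expl.
elim: h => [|h IH]; first by rewrite leqn0 muln_eq0 et.
rewrite leq_eqVlt => /orP[/eqP<-|h3]; last first.
  have {}h3 : (3 * t <= h)%N by [].
  have := IH h3; have := ht h; have := leq_mul Q1 (leqnn (Q ^ h)).
  rewrite expnS [(h.+1 * b)%N]mulSn; move: (Q * Q ^ h)%N (Q ^ h)%N (h * b)%N => X Y Z.
  by lia.
have h1 : (t.+1 * (t.+1 * t.+1) <= Q ^ (3 * t))%N.
  have h2 : (t.+1 <= Q ^ t)%N := ht t.
  by rewrite (mulnC 3) expnM !expnS expn0 muln1; apply: leq_mul => //; apply: leq_mul.
by apply: leq_trans h1; nia.
Qed.

Section Independence.
Variables (R : realType) (K : fieldType) (N : K -> R) (absN : nonarch_abs N).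
Variables (F : finFieldType) (emb : {rmorphism F -> K}) (x : K) (Q : nat).
Hypotheses (x_neq0 : x != 0) (x_lt1 : N x < 1) (Q_gt1 : (1 < Q)%N)
  (frobK : forall a b : K, (a + b) ^+ Q = a ^+ Q + b ^+ Q)
  (frobF : forall a : F, a ^+ Q = a).
Variables (J : finType) (k : J -> nat) (delta : J -> F).
Hypotheses (k_gt1 : forall j, (1 < k j)%N)
  (k_inj : forall j j' a b, (k j * Q ^ a = k j' * Q ^ b)%N -> j = j').
Notation C := {poly F}.
Notation A := {poly {poly F}}.
Notation ev := (ev emb x).
Notation evp := (evp emb x).
Notation KS := (\sum_j k j)%N.

Let Nx_gt0 : 0 < N x. Proof. by rewrite (abs_gt0 absN). Qed.
Let Nx_ge0 : 0 <= N x. Proof. exact: ltW. Qed.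
Let Nx_le1 : N x <= 1. Proof. exact: ltW. Qed.
Let Q_gt0 : (0 < Q)%N. Proof. exact: ltnW. Qed.
Let k_gt0 j : (0 < k j)%N. Proof. exact: ltnW. Qed.

Definition omega_factor (j : J) (m : nat) : K := 1 - x ^+ (k j * Q ^ m) / (x - emb (delta j)).
Definition partial_product (j : J) (s : nat) : K := \prod_(m < s) omega_factor j m.

Lemma abs_sub_emb_ge b : N x <= N (x - emb b).
Proof.
have [->|b0] := eqVneq b 0; first by rewrite rmorph0 subr0.
rewrite (absB absN) (abs_addl absN) ?(absNE absN);
  by rewrite (abs_emb absN _ b0).
Qed.

Lemma sub_emb_neq0 b : x - emb b != 0.
Proof. by rewrite -(abs_gt0 absN); apply: lt_le_trans (abs_sub_emb_ge b). Qed.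

Lemma abs_sub_emb_le1 b : N (x - emb b) <= 1.
Proof. by apply: (absB_le absN) => //; apply: (abs_emb_le1 absN). Qed.

(** The denominator costs at most one factor [N x], and [k j >= 2] gives
    [k j * Q ^ m - 1 >= Q ^ m]. *)
Lemma abs_omega_factor_sub1 j m : N (omega_factor j m - 1) <= N x ^+ (Q ^ m).
Proof.
have -> : omega_factor j m - 1 = - (x ^+ (k j * Q ^ m) / (x - emb (delta j))).
  by rewrite /omega_factor addrAC subrr add0r.
rewrite (absNE absN) (abs_div absN) ler_pdivrMr; last first.
  by rewrite (abs_gt0 absN) sub_emb_neq0.
apply: le_trans (ler_wpM2l _ (abs_sub_emb_ge _)); last by rewrite exprn_ge0.
rewrite -exprSr (absX absN); apply: ler_wiXn2l => //.
have := k_gt1 j; have : (0 < Q ^ m)%N by rewrite expn_gt0 Q_gt0.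
by move: (Q ^ m)%N (k j) => X Y; nia.
Qed.

Lemma abs_omega_factor_le1 j m : N (omega_factor j m) <= 1.
Proof.
rewrite -[omega_factor j m](subrK 1); apply: (absD_le absN); last by rewrite (abs1 absN).
by apply: le_trans (abs_omega_factor_sub1 j m) _; rewrite exprn_ile1.
Qed.

Lemma abs_partial_product_le1 j s : N (partial_product j s) <= 1.
Proof.
rewrite /partial_product (abs_prod absN); apply: prodr_ile1 => m _.
by rewrite (abs_ge0 absN) abs_omega_factor_le1.
Qed.

Lemma abs_mulB_le a b a' b' e : N a <= 1 -> N b' <= 1 ->
  N (a - a') <= e -> N (b - b') <= e -> N (a * b - a' * b') <= e.
Proof.
move=> a1 b1 h1 h2; have -> : a * b - a' * b' = a * (b - b') + (a - a') * b' by ring.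
apply: (absD_le absN); rewrite (absM absN).
  by apply: le_trans h2; rewrite ler_piMl ?(abs_ge0 absN).
by apply: le_trans h1; rewrite ler_piMr ?(abs_ge0 absN).
Qed.

Variables (L : nat) (D : nat) (nu : 'I_L.+1 -> J -> nat) (c : 'I_L.+1 -> C).
Hypotheses (nu_le : forall a j, (nu a j <= D)%N)
  (nu_inj : forall a b, nu a =1 nu b -> a = b) (c_neq0 : forall a, c a != 0).
Variable omega : J -> K.
Hypotheses (omega_approx : forall j s, N (omega j - partial_product j s) <= N x ^+ (Q ^ s))
  (omega_rel : \sum_a ev (c a) * \prod_j omega j ^+ nu a j = 0).
Notation relation_coef := (relation_coef k delta Q D nu c).

(** The factor in front is the same for all [a], so this vector is proportional to the terms of the
    relation with each [omega] truncated. *)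
Lemma ev_relation_coef s a : ev (relation_coef s a) =
  (\prod_j (x - emb (delta j)) ^+ (s * D)) * (ev (c a) * \prod_j partial_product j s ^+ nu a j).
Proof.
rewrite /relation_coef rmorphM rmorph_prod mulrCA; congr (_ * _).
transitivity (\prod_j ((x - emb (delta j)) ^+ (s * D) * partial_product j s ^+ nu a j));
  last by rewrite big_split.
apply: eq_bigr => j _.
have e0 : ev ('X - (delta j)%:P) = x - emb (delta j) by rewrite rmorphB evX evC.
have e m : ev ('X - zero_pt k delta Q j m) = (x - emb (delta j)) * omega_factor j m.
  rewrite rmorphB rmorphD rmorphXn evX evC /omega_factor mulrBr mulr1 mulrCA.
  rewrite mulfV ?mulr1 ?sub_emb_neq0 //.
  by rewrite opprD addrA.
rewrite rmorphM !rmorphXn rmorph_prod e0.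
under eq_bigr => m _ do rewrite e.
rewrite big_split prodr_const card_ord exprMn -/(partial_product j s).
by rewrite mulrAC; congr (_ * _); rewrite -!exprM -exprD -mulnDr subnKC.
Qed.


Lemma abs_omega_le1 j : N (omega j) <= 1.
Proof.
rewrite -[omega j](subrK (partial_product j 0)); apply: (absD_le absN).
  by apply: le_trans (omega_approx j 0) _; rewrite exprn_ile1.
exact: abs_partial_product_le1.
Qed.

Lemma abs_expB_le (a b : K) e n : 0 <= e -> N a <= 1 -> N b <= 1 ->
  N (a - b) <= e -> N (a ^+ n - b ^+ n) <= e.
Proof.
move=> e0 a1 b1 h; elim: n => [|n IH]; first by rewrite subrr (abs0 absN).
rewrite !exprS; apply: abs_mulB_le => //.
by rewrite (absX absN) exprn_ile1 ?(abs_ge0 absN).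
Qed.

(** Subtract the exact relation [omega_rel]: everything lies in the closed unit disc, so the only
    error is that of truncating the products. *)
Lemma abs_relation_le s : N (ev (\sum_a relation_coef s a)) <= N x ^+ (Q ^ s).
Proof.
have Ne0 : 0 <= N x ^+ (Q ^ s) by rewrite exprn_ge0.
rewrite rmorph_sum; under eq_bigr => a _ do rewrite ev_relation_coef.
rewrite -mulr_sumr (absM absN).
apply: (@le_trans _ _ (N (\sum_a ev (c a) * \prod_j partial_product j s ^+ nu a j))).
  rewrite ler_piMl ?(abs_ge0 absN) // (abs_prod absN).
  apply: prodr_ile1 => j _.
  by rewrite (abs_ge0 absN) (absX absN) exprn_ile1 ?(abs_ge0 absN) ?abs_sub_emb_le1.
have -> : \sum_a ev (c a) * \prod_j partial_product j s ^+ nu a j =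
    \sum_a ev (c a) * \prod_j partial_product j s ^+ nu a j
    - \sum_a ev (c a) * \prod_j omega j ^+ nu a j by rewrite omega_rel subr0.
rewrite -sumrB; apply: (abs_sum_le absN) => // a _.
rewrite -mulrBr (absM absN); apply: (@le_trans _ _
  (N (\prod_j partial_product j s ^+ nu a j - \prod_j omega j ^+ nu a j))).
  by rewrite ler_piMl ?(abs_ge0 absN) // (abs_ev_le1 absN _ x_lt1).
have pow1 (b : K) n : N b <= 1 -> N (b ^+ n) <= 1.
  by move=> b1; rewrite (absX absN) exprn_ile1 ?(abs_ge0 absN).
have [//] : N (\prod_j partial_product j s ^+ nu a j) <= 1 /\
   N (\prod_j partial_product j s ^+ nu a j - \prod_j omega j ^+ nu a j) <= N x ^+ (Q ^ s).
elim: (index_enum J) => [|j r [IH1 IH2]].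
  by rewrite !big_nil subrr (abs0 absN) (abs1 absN).
have p1 := abs_partial_product_le1 j s; have o1 := abs_omega_le1 j.
rewrite !big_cons; split.
  by rewrite (absM absN) mulr_ile1 ?(abs_ge0 absN) ?pow1.
apply: abs_mulB_le => //; rewrite ?pow1 //; last first.
  apply: abs_expB_le => //; by rewrite (absB absN).
rewrite (abs_prod absN); apply: prodr_ile1 => i _.
by rewrite (abs_ge0 absN) pow1 ?abs_omega_le1.
Qed.

Hypotheses (D_gt0 : (0 < D)%N) (J_gt0 : (0 < #|J|)%N).

(** The Casorati determinant is nonzero of [x]-degree at most [#|S| * u * Q ^ m], while the Schwarz
    lemma bounds its coefficients by [N x ^+ (Q ^ m * g)]; since [g] exceeds [L.+1 * u], the
    Liouville inequality is violated. *)
Lemma no_relation : False.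
Proof.
pose dc := (\max_a size (c a))%N.
have hdc a : deg_le dc (c a).
  by rewrite /deg_le; apply: leq_trans (leqnSn _); apply: (@leq_bigmax _ (fun a => size (c a))).
(* [C1 * Q ^ m] bounds the degrees of the relation vectors, [beta * Q ^ m] the
   [x]-degree of the auxiliary polynomials and [u * Q ^ m] that of the entries of
   the Casorati matrix; none of them depends on [g], the gain in the Schwarz lemma. *)
pose C1 := (dc + D * KS)%N.
pose beta := (2 * L * (1 + C1)).+1.
pose u := iter L.+1 (fun u => u * Q + D * KS)%N beta.
pose g := (L.+1 * u).+1.
pose d := #|F|.
have d_gt0 : (0 < d)%N by apply/card_gt0P; exists 0.
(* The number [m] of points exceeds the [t]-size [d * A0] only in the ratio [(2 * L).+2] to
   [(2 * L).+1], so the unknowns outnumber the equations once [beta] is large against [C1]. *)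
pose A0 := ((2 * L).+1 * g.+1)%N.
pose m := (d * (A0 + g.+1))%N.
pose B := (beta * Q ^ m)%N.
pose T := (C1 * Q ^ m)%N.
(* Truncating at [m - n] before substituting [x^(Q^n)] keeps the degrees below [C1 * Q ^ m] for
   every [n]. *)
pose r n a := relation_coef (m - n) a \Po 'X^(Q ^ n).
have hr n a : (n < m)%N -> deg_le T (r n a).
  move=> nm; have := deg_relation_coef_comp delta Q_gt1 k_gt1 nu_le (m - n) n (hdc a).
  by rewrite subnK // ltnW.
have hcount : (L * (\sum_(n < m) (d * A0 * Q ^ n + B + T)) < L.+1 * (d * A0) * B)%N.
  have hs : (\sum_(n < m) (d * A0 * Q ^ n + B + T) <= (d * A0 + m * (beta + C1)) * Q ^ m)%N.
    have eBT : (B + T = (beta + C1) * Q ^ m)%N by rewrite /B /T -mulnDl.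
    under eq_bigr => n _ do rewrite -addnA eBT.
    rewrite big_split /= -big_distrr /= sum_nat_const card_ord [leqRHS]mulnDl.
    by rewrite -[(m * _ * _)%N]mulnA leq_add // leq_mul2l (sum_expn_le Q_gt1) // orbT.
  apply: leq_ltn_trans (leq_mul (leqnn L) hs) _.
  rewrite mulnA /B [ltnRHS]mulnA ltn_pmul2r ?expn_gt0 ?Q_gt0 //.
  have y_gt0 : (0 < d * g.+1)%N by rewrite muln_gt0 d_gt0.
  have -> : m = ((2 * L).+2 * (d * g.+1))%N by rewrite /m /A0; lia.
  have -> : (d * A0 = (2 * L).+1 * (d * g.+1))%N by rewrite /A0; lia.
  have {y_gt0} := y_gt0; rewrite /beta; generalize (d * g.+1)%N C1 => y z y0.
  have -> : (L.+1 * ((2 * L).+1 * y) * (2 * L * (1 + z)).+1 =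
    L * ((2 * L).+1 * y + (2 * L).+2 * y * ((2 * L * (1 + z)).+1 + z)) + (2 * L).+1 * y)%N by lia.
  by rewrite -[ltnLHS]addn0 ltn_add2l muln_gt0.
have [P [[aP nP] sP cP relP]] := auxiliary_polynomials hr hcount.
(* Only indices with [P a != 0] enter, as the Casorati argument needs nonzero initial terms. *)
pose S := [set a | P a != 0].
pose f (b : 'I_#|S|) : 'I_L.+1 := enum_val b.
have f_inj : injective f by apply: enum_val_inj.
have fS b : P (f b) != 0 by have := enum_valP b; rewrite inE.
pose nu' b := nu (f b).
pose P' b := P (f b).
pose U := \matrix_(i < #|S|, b < #|S|) twisted_orbit (twist Q) (twist_coef k delta Q D nu' m) P' i b.
have U0 : \det U != 0.
  apply: casorati_det_neq0 => //.
    exact: twist_inj.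
  move=> s a b p q p0 q0 e; apply: f_inj; apply: nu_inj.
  exact: (twist_coef_inequiv Q_gt1 k_gt0 k_inj (fun b j => nu_le (f b) j) p0 q0 e).
have [h0 hh0] := affine_le_expn (C1 + m) (D * #|J|) Q_gt1.
pose h1 := (h0 + g.+1)%N.
have GE h : aux_form k delta Q D nu' P' m h = aux_form k delta Q D nu P m h.
  rewrite /aux_form [RHS](bigID (mem S)) /= [X in _ + X]big1 ?addr0.
    by rewrite [RHS]big_enum_val; apply: eq_bigr.
  by move=> a; rewrite inE negbK => /eqP ->; rewrite mul0r.
have W_gt0 : (0 < D * #|J|)%N by rewrite muln_gt0 D_gt0.
pose rho := N x ^+ (Q ^ m).
have hG h : (h1 <= h)%N -> disc_le N 0 1 (rho ^+ g) (evp (aux_form k delta Q D nu' P' m h)).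
  move=> hh; rewrite GE.
  apply: (aux_form_small absN x_neq0 x_lt1 Q_gt1 k_gt1 nu_le (A0 := A0) (c1 := C1)) => //.
  - by rewrite muln_gt0 d_gt0.
  - move=> n nm; have e := aux_form_eval (c := c) nu_le h (fun a => relP n a nm).
    rewrite subnK ?(ltnW nm) // in e.
    have hQn : (Q ^ m = Q ^ (m - n) * Q ^ n)%N by rewrite -expnD subnK // ltnW.
    have r0 : relation_coef (m - n) ord0 \Po 'X^(Q ^ n) != 0.
      by rewrite comp_poly_eq0 ?size_polyXn ?ltnS ?expn_gt0 ?Q_gt0 // relation_coef_neq0.
    (* Removing the factor [relation_coef] of [ord0] costs at most [N x ^+ (C1 * Q ^ m)], by the
       Liouville inequality. *)
    apply: le_trans (ler_wpM2l (abs_ge0 absN _)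
      (abs_ev_ge absN emb x_neq0 x_lt1 r0 (hr n ord0 nm))) _.
    rewrite -(absM absN) -rmorphM e rmorphM (absM absN).
    apply: le_trans (ler_piMl (abs_ge0 absN _) (abs_ev_le1 absN emb x_lt1 _)) _.
    rewrite (ev_comp emb x Q_gt1 frobK frobF) (absX absN).
    have -> : (Q ^ (m + h) = Q ^ (m - n + h) * Q ^ n)%N.
      by rewrite -expnD addnAC subnK // ltnW.
    rewrite exprM; apply: lerXn2r; rewrite ?nnegrE ?(abs_ge0 absN) ?exprn_ge0 //.
    exact: abs_relation_le.
  - by apply: hh0; apply: leq_trans hh; apply: leq_addr.
  apply: leq_trans (leq_pmulr _ W_gt0); apply: leq_trans hh; apply: leq_addl.
(* One vector of monomials serves all rows, since [H - i >= h1] for every [i < #|S|]. *)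
pose H := (h1 + #|S|)%N.
pose V := \col_(b < #|S|) trunc_monomial k delta Q D nu' m H b.
have hUV i : disc_le N 0 1 (rho ^+ g) (evp ((U *m V) i 0)).
  have [kp hk] := twisted_orbit_trunc_monomial k delta Q (nu := nu') (fun b => nu_le (f b)) m P' i.
  have iH : (i <= H)%N by apply: leq_trans (ltnW (ltn_ord i)) (leq_addl _ _).
  have -> : (U *m V) i 0 = kp * iter i (twist Q) (aux_form k delta Q D nu' P' m (H - i)).
    rewrite mxE /aux_form.
    rewrite (iter_morph_sum (twist Q)) mulr_sumr; apply: eq_bigr => b _.
    by rewrite !mxE -hk subnK.
  rewrite rmorphM -[rho ^+ g]mul1r; apply: (disc_leM absN) => //.
    exact: (evp_le1 absN emb x_lt1).
  apply: (iter_twist_le absN x_lt1 Q_gt1 frobK frobF); apply: hG.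
  by rewrite leq_subRL ?(leq_trans (leq_addl _ _)) // addnC leq_add2l ltnW.
have S_gt0 : (0 < #|S|)%N by apply/card_gt0P; exists aP; rewrite inE.
pose b0 := Ordinal S_gt0.
have S_le : (#|S| <= L.+1)%N by apply: leq_trans (max_card _) _; rewrite card_ord.
have hdet : disc_le N 0 1 (rho ^+ g) (evp (\det U)).
  (* Cramer's rule bounds a monomial times the determinant; the monomial cancels because its zeros
     lie in the closed unit disc. *)
  have eadj : (\adj U *m (U *m V)) b0 0 = trunc_monomial k delta Q D nu' m H b0 * \det U.
    by rewrite mulmxA mul_adj_mx mul_scalar_mx !mxE mulrC.
  have hadj : disc_le N 0 1 (rho ^+ g) (evp ((\adj U *m (U *m V)) b0 0)).
    rewrite mxE rmorph_sum; apply: (disc_le_sum absN) => //; first by rewrite !exprn_ge0.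
    move=> i _; rewrite rmorphM -[rho ^+ g]mul1r; apply: (disc_leM absN) => //.
    exact: (evp_le1 absN emb x_lt1).
  rewrite eadj rmorphM in hadj.
  exact: (cancellable_trunc_monomial absN x_lt1 hadj).
have iter_mono i n : (i <= n)%N ->
    (iter i (fun u => u * Q + D * KS) beta <= iter n (fun u => u * Q + D * KS) beta)%N.
  elim: n => [|n IH]; first by rewrite leqn0 => /eqP ->.
  rewrite leq_eqVlt => /orP[/eqP -> //|/IH /leq_trans]; apply.
  by rewrite iterS; apply: leq_trans (leq_addr _ _); rewrite leq_pmulr.
have cU : coef_deg_le (#|S| * (u * Q ^ m)) (\det U).
  apply: coef_deg_le_det => i b; rewrite mxE.
  apply: coef_deg_leW (coef_deg_twisted_orbit k delta D nu' Q_gt1 i (cP (f b))).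
  rewrite leq_mul2r; apply/orP; right; rewrite /u.
  by apply: iter_mono; apply: leq_trans (ltnW (ltn_ord i)) S_le.
(* The leading coefficient in [t] is a nonzero polynomial in [x], to which the Liouville inequality
   applies. *)
have hlead : N x ^+ (#|S| * (u * Q ^ m)) <= N x ^+ (Q ^ m * g).
  rewrite [leRHS]exprM; move/disc_le01: hdet => /(_ (size (\det U)).-1).
  rewrite coef_map; apply: le_trans.
  by apply: (abs_ev_ge absN emb x_neq0 x_lt1); rewrite ?cU // lead_coef_eq0.
move: hlead; rewrite ler_iXn2l //; apply/negP.
rewrite -ltnNge mulnA mulnC ltn_pmul2l ?expn_gt0 ?Q_gt0 //.
by rewrite ltnS leq_mul2r S_le orbT.
Qed.


End Independence.

(** * Descent of algebraic coefficients *)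

Section AlgebraicCoefficients.
Variables (k E : fieldType) (f : {rmorphism k -> E}).

(** Multiplication by [c] preserves the [k]-span of the entries of [b], which form a spanning family
    rather than a basis. *)
Definition stable_by D (b : 'rV[E]_D) (c : E) :=
  exists M : 'M[k]_D, c *: b = b *m map_mx f M.

(** [mxvec (b^T *m p)] lists the products of entries, and [c] acts on the first factor alone. *)
Lemma stable_tensor_l D1 D2 (b : 'rV[E]_D1) (p : 'rV[E]_D2) c :
  stable_by b c -> stable_by (mxvec (b^T *m p)) c.
Proof.
case=> M hM; exists (lin_mulmx M^T).
have -> : map_mx f (lin_mulmx M^T) = lin_mulmx (map_mx f M)^T :> 'M_(_, D1 * D2).
  by apply: map_lin_mx => X; rewrite map_mxM map_trmx.
by rewrite mul_vec_lin -linearZ /= scalemxAl -linearZ /= hM trmx_mul mulmxA.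
Qed.

Lemma stable_tensor_r D1 D2 (b : 'rV[E]_D1) (p : 'rV[E]_D2) c :
  stable_by p c -> stable_by (mxvec (b^T *m p)) c.
Proof.
case=> M hM; exists (lin_mulmxr M).
have -> : map_mx f (lin_mulmxr M) = lin_mulmxr (map_mx f M) :> 'M_(D1 * _, _).
  by apply: map_lin_mx => X; rewrite /= map_mxM.
by rewrite mul_vec_lin /= -linearZ /= scalemxAr hM mulmxA.
Qed.

(** Take the powers of [c] below the degree of a monic equation, with its companion matrix. The
    entry 1 keeps tensor products with [p] nonzero. *)
Lemma algebraic_stable c : algebraicOver f c ->
  exists D (p : 'rV[E]_D.+1), p 0 0 = 1 /\ stable_by p c.
Proof.
move=> /integral_algebraic [q mq qc].
have sq : (1 < size q)%N.
  have := root_size_gt1 _ qc; rewrite map_poly_eq0 monic_neq0 // size_map_poly; exact.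
case eD: (size q).-1 => [|D]; first by move: sq eD; case: (size q) => [|[|]].
exists D, (\row_i c ^+ i); split; first by rewrite mxE expr0.
exists (\matrix_(i, j) if (j < D)%N then (nat_of_ord i == j.+1)%:R else - q`_i).
apply/rowP => j; rewrite !mxE -exprS; under eq_bigr => i _ do rewrite !mxE.
case: (ltnP j D) => hj.
  rewrite (bigD1 (Ordinal (hj : (j.+1 < D.+1)%N))) //= eqxx rmorph_nat mulr_natr mulr1n.
  rewrite big1 ?addr0 // => i hi; rewrite (_ : (nat_of_ord i == j.+1) = false) ?rmorph0 ?mulr0 //.
  by apply: contraNF hi => /eqP e; apply/eqP/val_inj.
have -> : nat_of_ord j = D by apply/eqP; rewrite eqn_leq hj -ltnS ltn_ord.
have eS : size q = D.+2 by move: eD sq; case: (size q) => //= n ->.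
have lc : (map_poly f q)`_D.+1 = 1.
  by have := monicP mq; rewrite lead_coefE eS coef_map => ->; apply: rmorph1.
move: qc; rewrite rootE horner_coef size_map_poly eS big_ord_recr /= lc mul1r.
rewrite addrC addr_eq0 => /eqP ->; rewrite -sumrN; apply: eq_bigr => i _.
by rewrite coef_map rmorphN mulrN mulrC.
Qed.

Lemma algebraic_stable_family r (c : 'I_r -> E) : (forall i, algebraicOver f (c i)) ->
  exists D (b : 'rV[E]_D), b != 0 /\ forall i, stable_by b (c i).
Proof.
elim: r c => [|r IH] c hc.
  by exists 1%N, (const_mx 1); split; [apply/rV0Pn; exists 0; rewrite mxE oner_eq0|case].
have [D [b [b0 hb]]] := IH (fun i => c (lift ord0 i)) (fun i => hc _).
have [D2 [p [p0 hp]]] := algebraic_stable (hc ord0).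
exists (D * D2.+1)%N, (mxvec (b^T *m p)); split.
  case/rV0Pn: b0 => i bi; apply/rV0Pn; exists (mxvec_index i 0).
  by rewrite mxvecE mxE big_ord1 mxE p0 mulr1.
move=> i; case: (unliftP ord0 i) => [j ->|->]; first exact: stable_tensor_l.
exact: stable_tensor_r.
Qed.

Variables (n : nat) (w : 'I_n -> E).
Notation kX := (mpoly.mpoly n k).

Hypothesis w_free : forall P : kX, mpoly.mmap f w P = 0 -> P = 0.

(* Multiplication by a polynomial with algebraic coefficients is given by a
   matrix with entries in [k[X]]; its determinant vanishes at [w], and its
   kernel is excluded by looking at leading monomials. *)
Lemma algebraic_independent_descent (P : mpoly.mpoly n E) :
  (forall m, algebraicOver f (mpoly.mcoeff m P)) -> mpoly.meval w P = 0 -> P = 0.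
Proof.
move=> algP Pw; apply/eqP; case: eqP => // /eqP P0; exfalso.
pose ms := mpoly.msupp P; pose m0 := mpoly.mlead P.
have c0 : mpoly.mcoeff m0 P != 0 by rewrite mpoly.mleadc_eq0.
(* Normalising the leading coefficient to 1 allows the identity matrix at the leading monomial. *)
pose a (i : 'I_(size ms)) := mpoly.mcoeff (nth m0 ms i) P / mpoly.mcoeff m0 P.
have [D [b [b0 hb]]] : exists D (b : 'rV[E]_D), b != 0 /\ forall i, stable_by b (a i).
  by apply: algebraic_stable_family => i; apply: algebraic_div.
have [M0 hM0] := fin_all_exists hb.
have m0s : m0 \in ms by apply: mpoly.mlead_supp.
have i0lt : (index m0 ms < size ms)%N by rewrite index_mem.
pose i0 : 'I_(size ms) := Ordinal i0lt.
have ni0 : nth m0 ms i0 = m0 by rewrite nth_index.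
pose M i := if i == i0 then 1%:M else M0 i.
have hM i : a i *: b = b *m map_mx f (M i).
  rewrite /M; case: eqP => // ->.
  by rewrite map_mx1 mulmx1 /a ni0 mulfV // scale1r.
pose Mx : 'M[kX]_D := \matrix_(u, v) \sum_(i < size ms) M i u v *: mpoly.mpolyX k (nth m0 ms i).
have bMx : b *m map_mx (mpoly.mmap f w) Mx = 0.
  transitivity (\sum_(i < size ms) mpoly.mmap1 w (nth m0 ms i) *: (b *m map_mx f (M i))).
    apply/rowP => v; rewrite summxE mxE.
    under [RHS]eq_bigr => i _ do rewrite !mxE mulr_sumr.
    rewrite exchange_big; apply: eq_bigr => u _ /=.
    rewrite !mxE rmorph_sum mulr_sumr; apply: eq_bigr => i _ /=.
    by rewrite mpoly.mmapZ mpoly.mmapX mxE mulrA mulrC.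
  under eq_bigr => i _ do rewrite -hM scalerA.
  rewrite -scaler_suml; apply/eqP; rewrite scaler_eq0; apply/orP; left; apply/eqP.
  transitivity (mpoly.meval w P / mpoly.mcoeff m0 P); last by rewrite Pw mul0r.
  rewrite mpoly.mevalE mulr_suml (big_nth m0) big_mkord; apply: eq_bigr => i _.
  by rewrite /a mulrC mulrAC.
have : \det Mx == 0.
  apply/eqP/w_free; rewrite -det_map_mx; apply/eqP/det0P.
  by exists b.
case/det0P => v v0 hv.
(* For an entry [j] of the kernel vector with greatest leading monomial [mu], the monomial [m0 + mu]
   in column [j] of [v *m Mx] comes only from [v 0 j] and the identity matrix. *)
have [j vj hj] : exists2 j, v 0 j != 0 &
    forall i, v 0 i != 0 -> (mpoly.mlead (v 0 i) <= mpoly.mlead (v 0 j))%O.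
  case/rV0Pn: v0 => j vj.
  case: (@Order.TotalTheory.arg_maxP _ _ _ j (fun i => v 0 i != 0)
    (fun i => mpoly.mlead (v 0 i)) vj) => i vi hi; exists i => //.
pose mu := mpoly.mlead (v 0 j).
have /rowP/(_ j) := hv; rewrite [RHS]mxE mxE => /(congr1 (mpoly.mcoeff (mpoly.mnm_add m0 mu))).
have termE u : mpoly.mcoeff (mpoly.mnm_add m0 mu) (v 0 u * Mx u j)
    = if u == j then mpoly.mcoeff mu (v 0 j) else 0.
  rewrite mxE mulr_sumr raddf_sum (bigD1 i0) //= big1 ?addr0 => [|i hi].
    rewrite -scalerAr mpoly.mcoeffZ ni0 mpoly.mcoeffMX /M eqxx mxE.
    by case: eqP => [->|_]; rewrite ?mul1r ?mul0r.
  rewrite -scalerAr mpoly.mcoeffZ; have [->|vu] := eqVneq (v 0 u) 0.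
    by rewrite mul0r mpoly.mcoeff0 mulr0.
  rewrite mpoly.mcoeff_gt_mlead ?mulr0 //.
  apply: le_lt_trans (mpoly.mleadM_le _ _) _; rewrite mpoly.mleadXm mpoly.addmC.
  apply: mpoly.ltmc_le_add; last exact: hj.
  rewrite lt_neqAle mpoly.msupp_le_mlead ?mem_nth // andbT -/m0 -[X in _ != X]ni0.
  by rewrite nth_uniq ?mpoly.msupp_uniq // ltn_ord.
rewrite raddf_sum (eq_bigr _ (fun u _ => termE u)) -big_mkcond big_pred1_eq mpoly.mcoeff0 => /eqP.
by rewrite mpoly.mleadc_eq0 (negbTE vj).
Qed.

End AlgebraicCoefficients.

(** * Limits and v-adic absolute values *)

From mathcomp Require Import qfpoly generic_quotient.
From mathcomp Require pgroup abelian.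
From mathcomp Require Import classical_sets topology normedtype sequences.
Import numFieldNormedType.Exports.
Local Open Scope classical_set_scope.
Local Open Scope ring_scope.

Section Limits.
Variables (R : realType) (K : fieldType) (N : K -> R) (absN : nonarch_abs N).

Lemma tends_toP (u : nat -> K) l : tends_to N u l <->
  forall e, 0 < e -> exists n0, forall n, (n0 <= n)%N -> N (u n - l) < e.
Proof.
have Nn n : `|N (u n - l)| = N (u n - l) by rewrite ger0_norm ?(abs_ge0 absN).
split=> [/cvgr0Pnorm_lt h e e0|h].
  have [n0 _ hn0] := h e e0; exists n0 => n nn0; rewrite -Nn; exact: hn0.
apply/cvgr0Pnorm_lt => e e0; have [n0 hn0] := h e e0.
by exists n0 => // n /= nn0; rewrite Nn; apply: hn0.
Qed.

Lemma tends_to_abs_le (u : nat -> K) l a C n0 : tends_to N u l ->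
  (forall n, (n0 <= n)%N -> N (u n - a) <= C) -> N (l - a) <= C.
Proof.
move=> /tends_toP h hC; rewrite leNgt; apply/negP => lC.
have C0 : 0 <= C by apply: le_trans (hC n0 (leqnn _)); apply: (abs_ge0 absN).
have [n1 hn1] := h _ (le_lt_trans C0 lC).
pose n := maxn n0 n1.
have [_ _ _ hD] := absN; have := hD (l - u n) (u n - a).
rewrite addrA subrK leNgt gt_max (absB absN) hn1 ?leq_maxr //=.
by rewrite (le_lt_trans _ lC) // hC ?leq_maxl.
Qed.

Lemma expn_fast_lt (r e : R) Q : 0 < r -> r < 1 -> (1 < Q)%N -> 0 < e ->
  exists n, r ^+ (Q ^ n) < e.
Proof.
move=> r0 r1 Q1 e0.
have rn : `|r| < 1 by rewrite ger0_norm // ltW.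
have /cvgr0Pnorm_lt /(_ e e0) [n _ hn] := cvg_expr rn.
exists n; have := hn n (leqnn n); rewrite ger0_norm ?exprn_ge0 ?(ltW r0) //.
apply: le_lt_trans; apply: ler_wiXn2l; [exact: ltW|exact: ltW|].
by apply: ltnW; apply: ltn_expl.
Qed.

Lemma lim_absP (u : nat -> K) : (exists l, tends_to N u l) -> tends_to N u (lim_abs N u).
Proof. exact: xgetPex. Qed.

Section FastCauchy.
Variables (r : R) (Q : nat) (u : nat -> K).
Hypotheses (r_gt0 : 0 < r) (r_lt1 : r < 1) (Q_gt1 : (1 < Q)%N)
  (u_step : forall n, N (u n.+1 - u n) <= r ^+ (Q ^ n)).

Lemma fast_cauchy_dist n m : (n <= m)%N -> N (u m - u n) <= r ^+ (Q ^ n).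
Proof.
elim: m => [|m IH]; first by rewrite leqn0 => /eqP ->; rewrite subrr (abs0 absN) exprn_ge0 // ltW.
rewrite leq_eqVlt => /orP[/eqP <-|nm].
  by rewrite subrr (abs0 absN) exprn_ge0 // ltW.
have -> : u m.+1 - u n = (u m.+1 - u m) + (u m - u n) by rewrite addrA subrK.
apply: (absD_le absN); last exact: IH.
apply: le_trans (u_step m) _; apply: ler_wiXn2l; [exact: ltW|exact: ltW|].
by rewrite leq_exp2l.
Qed.

Lemma fast_cauchy_cvg : complete_abs N -> exists l, tends_to N u l.
Proof.
apply=> e e0; have [n0 hn0] := expn_fast_lt r_gt0 r_lt1 Q_gt1 e0.
exists n0 => m n hm hn; apply: le_lt_trans hn0.
have -> : u m - u n = (u m - u n0) - (u n - u n0) by rewrite opprB addrA subrK.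
by apply: (absB_le absN); apply: fast_cauchy_dist.
Qed.

Lemma fast_cauchy_lim_dist l n : tends_to N u l -> N (l - u n) <= r ^+ (Q ^ n).
Proof. by move=> hl; apply: (tends_to_abs_le hl (n0 := n)) => m nm; apply: fast_cauchy_dist. Qed.

End FastCauchy.

Lemma fast_eq0 (r : R) (Q : nat) a : 0 < r -> r < 1 -> (1 < Q)%N ->
  (forall n, N a <= r ^+ (Q ^ n)) -> a = 0.
Proof.
move=> r0 r1 Q1 h; apply/eqP; rewrite -[_ == _]negbK -(abs_gt0 absN); apply/negP => a0.
have [n hn] := expn_fast_lt r0 r1 Q1 a0.
by have := le_lt_trans (h n) hn; rewrite ltxx.
Qed.

End Limits.

(** The additive group of [F] is an elementary abelian [p]-group, so [#|F|] is a power of the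
    characteristic. *)
Lemma finField_card_frobenius (F : finFieldType) (K : fieldType) (g : {rmorphism F -> K})
    (a b : K) n : (a + b) ^+ (#|F| ^ n) = a ^+ (#|F| ^ n) + b ^+ (#|F| ^ n).
Proof.
have [p _ pF] := finPcharP F.
have pK : p \in [pchar K] by rewrite (fmorph_pchar g).
apply: exprDn_pchar.
rewrite pnatX (eq_pnat _ (pcharf_eq pK)) -cardsT.
have /abelian.abelem_pgroup := abelian.fin_ring_pchar_abelem pF.
by rewrite /pgroup.pgroup => ->.
Qed.

Section Fractions.
Variable F : fieldType.

Lemma fraction_repr (x : {fraction {poly F}}) :
  x * FracField.tofrac (\d_(repr x)) = FracField.tofrac (\n_(repr x)).
Proof.
rewrite -{1}[x]reprK; unlock FracField.tofrac; rewrite -[LHS]FracField.pi_mul.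
apply/eqmodP; rewrite /= FracField.equivfE /FracField.mulf !numden_Ratio ?oner_neq0 //.
- by rewrite !mulr1 mulrC.
- by rewrite mulr1 denom_ratioP.
by rewrite mulr1 denom_ratioP.
Qed.

Lemma common_denominator n (a : 'I_n -> {fraction {poly F}}) :
  exists2 b : {poly F}, b != 0 & exists p : 'I_n -> {poly F},
    forall i, a i * FracField.tofrac b = FracField.tofrac (p i).
Proof.
exists (\prod_i \d_(repr (a i))); first by apply/prodf_neq0 => i _; apply: denom_ratioP.
exists (fun i => \n_(repr (a i)) * \prod_(j | j != i) \d_(repr (a j))) => i.
by rewrite (bigD1 i) //= !rmorphM mulrA fraction_repr.
Qed.

End Fractions.

Section VadicAbs.
Variables (R : realType) (F : finFieldType) (v : {poly F}).
Hypothesis v_irr : irreducible_poly v.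

Lemma size_v_gt1 : (1 < size v)%N. Proof. by case: v_irr. Qed.

Lemma ord_poly_dvd (a : {poly F}) : a != 0 -> v ^+ ord_poly v a %| a.
Proof.
move=> a0; rewrite /ord_poly.
have sa : (0 < size a)%N by rewrite size_poly_gt0.
apply: (big_ind (fun n => v ^+ n %| a)) => //.
- by rewrite expr0 dvd1p.
- by move=> m n hm hn; rewrite /maxn; case: ifP.
Qed.

Lemma leq_ord_poly (a : {poly F}) n : a != 0 -> v ^+ n %| a -> (n <= ord_poly v a)%N.
Proof.
move=> a0 h; have na : (n < size a)%N.
  apply: leq_trans (dvdp_leq a0 h).
  have v0 : (0 < size (v ^+ n)%R)%N.
    by rewrite size_poly_gt0 expf_neq0 // -size_poly_gt0 ltnW // size_v_gt1.
  rewrite -(prednK v0) ltnS size_exp leq_pmull // -ltnS prednK ?size_v_gt1 //.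
  by rewrite ltnW // size_v_gt1.
by apply: (leq_bigmax_cond (Ordinal na)).
Qed.

(** The representative of [p] may be an unreduced fraction [a / b]; from [a = p * b] the order of
    [a] exceeds that of [b] by at least [n]. *)
Lemma vadic_abs_tofrac (p : {poly F}) n : v ^+ n %| p ->
  vadic_abs R v (FracField.tofrac p) <= ((#|F| ^ deg_poly v)%N%:R)^-1 ^+ n.
Proof.
move=> hp; rewrite /vadic_abs; set x := FracField.tofrac p.
set c : R := _%:R.
have c0 : 0 < c by rewrite ltr0n expn_gt0 (ltnW (card_finNzRing_gt1 F)).
case: eqP => [_|/eqP a0]; first by rewrite exprn_ge0 // invr_ge0 ltW.
have e : p * \d_(repr x) = \n_(repr x).
  by apply/eqP; rewrite -tofrac_eq -fraction_repr -rmorphM.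
have b0 : \d_(repr x) != 0 by apply: denom_ratioP.
have h : (n + ord_poly v (\d_(repr x)) <= ord_poly v (\n_(repr x)))%N.
  apply: leq_ord_poly => //; rewrite -e exprD; apply: dvdp_mul => //.
  exact: ord_poly_dvd.
rewrite ler_pdivrMr ?exprn_gt0 // exprVn ler_pdivlMl ?exprn_gt0 // -exprD.
apply: ler_weXn2l => //.
by rewrite ler1n expn_gt0 (ltnW (card_finNzRing_gt1 F)).
Qed.

End VadicAbs.

(** * The products Omega *)

Section Residue.
Variables (F : finFieldType) (v : {poly F}).
Hypothesis hv : monic_irreducible_poly v.
Notation d := (size v).-1.
Notation FF := {poly %/ v with hv}.

(** The residue field of [v] has [q ^ d] elements, so the class of ['X] is fixed by the power
    [q ^ d]. *)
Lemma dvdp_XqdBX : v %| 'X^(#|F| ^ d) - 'X.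
Proof.
have h : in_qpoly v ('X^(#|F| ^ d) - 'X) = 0 :> FF.
  rewrite rmorphB rmorphXn /= -(card_qfpoly hv).
  by rewrite (expf_card (in_qpoly v 'X : FF)) subrr.
have := congr1 (fun p : FF => polyn p) h; rewrite /= mk_monicE // => /eqP.
by rewrite -Pdiv.IdomainMonic.modpE ?hv.
Qed.

Lemma qfpoly_embedding (K : fieldType) (g : {rmorphism F -> K}) (z : K) :
  (map_poly g v).[z] = 0 ->
  exists emb : {rmorphism FF -> K},
    emb (in_qpoly v 'X) = z /\ forall a, exists b, emb b = g a.
Proof.
move=> vz; pose h (p : FF) : K := (map_poly g (polyn p)).[z].
have hmod p : h (in_qpoly v p) = (map_poly g p).[z].
  rewrite /h /= mk_monicE // -Pdiv.IdomainMonic.modpE ?hv //.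
  by rewrite [in RHS](divp_eq p v) rmorphD rmorphM hornerD hornerM vz mulr0 add0r.
have hz : zmod_morphism h by move=> p p'; rewrite /h /= rmorphB hornerD hornerN.
have hm : monoid_morphism h.
  split; first by rewrite /h /= rmorph1 hornerC.
  move=> p p'; rewrite -[LHS]/(h (in_qpoly v (polyn p * polyn p'))) hmod.
  by rewrite rmorphM hornerM.
pose emb : {rmorphism FF -> K} := HB.pack h
  (GRing.isZmodMorphism.Build _ _ h hz) (GRing.isMonoidMorphism.Build _ _ h hm).
exists emb; split; first by rewrite [LHS]hmod map_polyX hornerX.
by move=> a; exists (in_qpoly v a%:P); rewrite [LHS]hmod map_polyC hornerC.
Qed.

End Residue.

Lemma prod_nat_mul (K : fieldType) (d s : nat) (f : nat -> K) :
  \prod_(0 <= n < d * s) f n = \prod_(r < d) \prod_(m < s) f (d * m + r)%N.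
Proof.
rewrite exchange_big; elim: s => [|s IH]; first by rewrite muln0 big_nil big_ord0.
rewrite big_ord_recr /= -IH (big_cat_nat (n := d * s)) ?leq_mul2l ?leqnSn ?orbT //=.
congr (_ * _); rewrite -{1}[(d * s)%N]add0n big_addn mulnS addnK big_mkord.
by apply: eq_bigr => r _; rewrite addnC.
Qed.

Section Omega.
Variables (R : realType) (F : finFieldType) (v : {poly F}).
Hypotheses (v_monic : v \is monic) (v_irr : irreducible_poly v).
Variables (kv : fieldType) (Nkv : kv -> R) (j1 : {rmorphism {fraction {poly F}} -> kv}).
Hypothesis kv_completion : is_completion (vadic_abs R v) Nkv j1.

Notation q := #|F|.
Notation d := (deg_poly v).
Let hv : monic_irreducible_poly v := (v_irr, v_monic).
Notation FF := {poly %/ v with hv}.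
Notation theta := (theta j1).
Notation eps := (teichmuller v Nkv j1).

Let absN : nonarch_abs Nkv. Proof. by case: kv_completion. Qed.
Let compN : complete_abs Nkv. Proof. by case: kv_completion. Qed.

Definition poly_embed : {rmorphism {poly F} -> kv} := (j1 \o @FracField.tofrac {poly F}).
Definition const_embed : {rmorphism F -> kv} := (poly_embed \o polyC).

Let q_gt1 : (1 < q)%N. Proof. exact: card_finNzRing_gt1. Qed.
Let q_gt0 : (0 < q)%N. Proof. exact: ltnW. Qed.

Lemma deg_gt0 : (0 < d)%N.
Proof. by rewrite /deg_poly -ltnS prednK ?(size_v_gt1 v_irr) // ltnW // (size_v_gt1 v_irr). Qed.

Let qd_gt1 : (1 < q ^ d)%N.
Proof. by rewrite -(expn0 q) ltn_exp2l // deg_gt0. Qed.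

Lemma poly_embed_inj : injective poly_embed.
Proof. by move=> a b /(fmorph_inj j1)/eqP; rewrite tofrac_eq => /eqP. Qed.

Lemma abs_poly_embed_le p n : v ^+ n %| p -> Nkv (poly_embed p) <= ((q ^ d)%N%:R)^-1 ^+ n.
Proof.
case: kv_completion => _ h _ _ hp; rewrite /poly_embed /= h.
exact: vadic_abs_tofrac.
Qed.

Lemma abs_poly_embed_le1 p : Nkv (poly_embed p) <= 1.
Proof. by have := @abs_poly_embed_le p 0 _; rewrite expr0 dvd1p => /(_ isT). Qed.

Lemma abs_poly_embed_lt1 p : v %| p -> Nkv (poly_embed p) < 1.
Proof.
move=> h; apply: le_lt_trans (@abs_poly_embed_le p 1 _) _; first by rewrite expr1.
by rewrite expr1 invf_lt1 ?ltr1n // ltr0n ltnW.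
Qed.

Lemma horner_map_MXaddC p a z :
  (map_poly const_embed (p * 'X + a%:P)).[z] = (map_poly const_embed p).[z] * z + const_embed a.
Proof.
rewrite (rmorphD (map_poly const_embed)) (rmorphM (map_poly const_embed)) /= map_polyX map_polyC.
by rewrite hornerD hornerMX hornerC.
Qed.

Lemma poly_embedE p : poly_embed p = (map_poly const_embed p).[theta].
Proof.
elim/poly_ind: p => [|p a IH]; first by rewrite !rmorph0 horner0.
by rewrite rmorphD rmorphM IH horner_map_MXaddC.
Qed.

Lemma frob_kv (a b : kv) n : (a + b) ^+ (q ^ n) = a ^+ (q ^ n) + b ^+ (q ^ n).
Proof. exact: (finField_card_frobenius const_embed). Qed.

Lemma frobB_kv (a b : kv) n : (a - b) ^+ (q ^ n) = a ^+ (q ^ n) - b ^+ (q ^ n).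
Proof. by apply/eqP; rewrite eq_sym subr_eq -frob_kv subrK. Qed.

Let r := Nkv (theta ^+ (q ^ d) - theta).

Let theta_qd : theta ^+ (q ^ d) - theta = poly_embed ('X^(q ^ d) - 'X).
Proof. by rewrite rmorphB rmorphXn. Qed.

Lemma theta_qd_neq0 : theta ^+ (q ^ d) - theta != 0.
Proof.
rewrite theta_qd -(rmorph0 poly_embed) (inj_eq poly_embed_inj) subr_eq0; apply/eqP => e.
have := congr1 (fun p : {poly F} => size p) e; rewrite size_polyXn size_polyX => -[e1].
by have := qd_gt1; rewrite e1 ltnn.
Qed.

Let r_gt0 : 0 < r. Proof. by rewrite (abs_gt0 absN) theta_qd_neq0. Qed.
Let r_lt1 : r < 1.
Proof. by rewrite /r theta_qd; apply: abs_poly_embed_lt1; apply: (dvdp_XqdBX hv). Qed.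

Let u i := theta ^+ (q ^ (i * d))%N.

(** Successive differences are Frobenius powers of the first one. *)
Let u_step n : Nkv (u n.+1 - u n) <= r ^+ ((q ^ d) ^ n).
Proof.
rewrite /u mulSn expnD exprM -frobB_kv (absX absN) -expnM mulnC.
exact: lexx.
Qed.

Lemma teichmuller_tends : tends_to Nkv u eps.
Proof. by apply: lim_absP; apply: (fast_cauchy_cvg absN r_gt0 r_lt1 qd_gt1 u_step compN). Qed.

Let eps_dist n : Nkv (eps - u n) <= r ^+ ((q ^ d) ^ n).
Proof. exact: (fast_cauchy_lim_dist absN r_gt0 r_lt1 qd_gt1 u_step n teichmuller_tends). Qed.

(** The power [q ^ d] takes [u n] to [u n.+1], and both are arbitrarily close to [eps]. *)
Lemma teichmuller_fixed : eps ^+ (q ^ d) = eps.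
Proof.
apply/eqP; rewrite -subr_eq0; apply/eqP/(fast_eq0 absN r_gt0 r_lt1 qd_gt1) => n.
have -> : eps ^+ (q ^ d) - eps = (eps - u n) ^+ (q ^ d) - (eps - u n.+1).
  rewrite frobB_kv opprB addrA; congr (_ - _).
  by rewrite /u -exprM -expnD addnC -mulSn subrK.
apply: (absB_le absN).
  rewrite (absX absN); apply: le_trans (eps_dist n).
  rewrite -[X in _ ^+ X]prednK ?(ltnW qd_gt1) // exprS ler_piMr ?(abs_ge0 absN) //.
  rewrite exprn_ile1 ?(abs_ge0 absN) //; apply: le_trans (eps_dist n) _.
  by rewrite exprn_ile1 // ltW.
apply: le_trans (eps_dist n.+1) _; apply: ler_wiXn2l; [exact: ltW|exact: ltW|].
by rewrite leq_exp2l.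
Qed.

Lemma abs_theta_sub_lt1 : Nkv (theta - eps) < 1.
Proof.
rewrite (absB absN); have := eps_dist 0; rewrite /u mul0n expn0 expr1 => h.
by apply: le_lt_trans h _; rewrite expn0 expr1.
Qed.

Lemma theta_sub_neq0 : theta - eps != 0.
Proof.
rewrite subr_eq0; apply/eqP => e; have := theta_qd_neq0.
by rewrite {1}e teichmuller_fixed -e subrr eqxx.
Qed.

(** [v(eps)] is fixed by the power [q ^ d], hence 0 or of absolute value 1; the latter is
    impossible, since it is close to [v(theta)], which is small. *)
Lemma v_teichmuller : (map_poly const_embed v).[eps] = 0.
Proof.
have gfix (a : F) : const_embed a ^+ (q ^ d) = const_embed a.
  rewrite -rmorphXn; elim: (deg_poly v) => [|n IH]; first by rewrite expn0 expr1.
  by rewrite expnS exprM expf_card.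
have g1 (a : F) : Nkv (const_embed a) <= 1 by apply: abs_poly_embed_le1.
have th1 : Nkv theta <= 1 by rewrite /theta; apply: abs_poly_embed_le1.
have ep1 : Nkv eps <= 1.
  rewrite -[eps](subrK theta); apply: (absD_le absN) => //.
  by rewrite (absB absN) ltW // abs_theta_sub_lt1.
have pow (p : {poly F}) :
    (map_poly const_embed p).[eps] ^+ (q ^ d) = (map_poly const_embed p).[eps].
  elim/poly_ind: p => [|p a IH]; first by rewrite rmorph0 horner0 expr0n gtn_eqF // ltnW.
  rewrite horner_map_MXaddC frob_kv exprMn IH gfix.
  by rewrite teichmuller_fixed.
have close (p : {poly F}) : Nkv (map_poly const_embed p).[eps] <= 1 /\
    Nkv ((map_poly const_embed p).[eps] - (map_poly const_embed p).[theta]) <= Nkv (theta - eps).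
  elim/poly_ind: p => [|p a [IH1 IH2]].
    by rewrite rmorph0 !horner0 subrr (abs0 absN) (abs_ge0 absN).
  rewrite !horner_map_MXaddC; split.
    by apply: (absD_le absN) => //; rewrite (absM absN) mulr_ile1 ?(abs_ge0 absN).
  rewrite opprD addrACA subrr addr0; apply: (abs_mulB_le absN) => //.
  by rewrite (absB absN).
apply/eqP; apply/negPn/negP => v0.
have : Nkv (map_poly const_embed v).[eps] = 1.
  apply: (abs_root1 absN (n := (q ^ d).-1)); first by rewrite -ltnS prednK // ltnW.
  by apply: (mulfI v0); rewrite -exprS prednK ?mulr1 ?pow // ltnW.
have vt : Nkv (map_poly const_embed v).[theta] < 1 by rewrite -poly_embedE abs_poly_embed_lt1.
rewrite -[(map_poly const_embed v).[eps]](subrK (map_poly const_embed v).[theta]) => h1.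
have [_ _ _ hD] := absN.
have := hD ((map_poly const_embed v).[eps] - (map_poly const_embed v).[theta])
  (map_poly const_embed v).[theta].
rewrite h1 leNgt gt_max vt andbT; move/negP; apply.
by apply: le_lt_trans (proj2 (close v)) abs_theta_sub_lt1.
Qed.

(** * Splitting the products Omega into elementary products *)

Section Factors.
Variables (FF : finFieldType) (emb : {rmorphism FF -> kv}) (e : FF).
Hypotheses (cardFF : #|FF| = (q ^ d)%N) (emb_e : emb e = eps)
  (emb_gF : forall a, exists b, emb b = const_embed a).
Variable l : nat.
Hypothesis l_gt0 : (0 < l)%N.

Notation x := (theta - eps).
Notation Q := (q ^ (d * l))%N.
Notation J := ('I_l * 'I_d)%type.

(** The pair [(i, r)] stands for the factors of the product of index [i.+1] with [n = r] modulo [d];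
    the exponents run once through [q^1, ..., q^(d l)]. *)
Definition omega_exp (j : J) : nat := (q ^ (j.1.+1 + l * j.2))%N.
(** Chosen so that [x - emb (omega_shift j)] is the denominator [theta - eps ^+ omega_exp j]. *)
Definition omega_shift (j : J) : FF := e ^+ omega_exp j - e.

Let x_gt0 : 0 < Nkv x. Proof. by rewrite (abs_gt0 absN) theta_sub_neq0. Qed.
Let x_lt1 : Nkv x < 1 := abs_theta_sub_lt1.
Let dl_gt0 : (0 < d * l)%N. Proof. by rewrite muln_gt0 deg_gt0. Qed.
Let Q_gt1 : (1 < Q)%N. Proof. by rewrite -(expn0 q) ltn_exp2l. Qed.
Let ql_gt1 : (1 < q ^ l)%N. Proof. by rewrite -(expn0 q) ltn_exp2l. Qed.

Lemma frob_residue (a : FF) n : a ^+ (Q ^ n) = a.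
Proof.
elim: n => [|n IH]; first by rewrite expn0 expr1.
rewrite expnS exprM; have -> : a ^+ Q = a; last exact: IH.
rewrite expnM -cardFF; elim: l => [|l' IH']; first by rewrite expn0 expr1.
by rewrite expnS exprM expf_card.
Qed.

(** Since [theta = x + eps], a polynomial in [theta] over [F] is one in [x] over the residue
    field. *)
Lemma lift_poly p : exists c : {poly FF}, ev emb x c = poly_embed p.
Proof.
elim/poly_ind: p => [|p a [c hc]]; first by exists 0; rewrite !rmorph0.
have [b hb] := emb_gF a.
exists (c * ('X + e%:P) + b%:P).
rewrite rmorphD rmorphM rmorphD evX !evC hc emb_e hb subrK.
by rewrite rmorphD rmorphM.
Qed.

Lemma omega_exp_gt1 j : (1 < omega_exp j)%N.
Proof. by rewrite /omega_exp -{1}(expn0 q) ltn_exp2l. Qed.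

(** Both sides are powers of [q]; the exponent determines the first index modulo [l] and then the
    second modulo [d]. *)
Lemma omega_exp_inj (j j' : J) a b : (omega_exp j * Q ^ a = omega_exp j' * Q ^ b)%N -> j = j'.
Proof.
rewrite /omega_exp -!expnM -!expnD => /eqP; rewrite eqn_exp2l // => /eqP.
case: j j' => [i s] [i' s'] /= h.
have {h} : (i + l * (s + d * a) = i' + l * (s' + d * b))%N.
  by apply/succn_inj; rewrite !mulnDr !mulnA (mulnC l d) !addnA; apply: h.
move=> h.
have ei : (i = i' :> nat).
  have := congr1 (modn ^~ l) h.
  by rewrite /= ![(_ + l * _)%N]addnC ![(l * _)%N]mulnC !modnMDl !modn_small.
have {}h : (s + d * a = s' + d * b)%N.
  by move: h; rewrite ei => /addnI /eqP; rewrite eqn_pmul2l // => /eqP.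
have es : (s = s' :> nat).
  have := congr1 (modn ^~ d) h.
  by rewrite /= ![(_ + d * _)%N]addnC ![(d * _)%N]mulnC !modnMDl !modn_small.
by congr (_, _); apply: val_inj.
Qed.

Definition Omega_factor (M : nat) : kv := 1 - x ^+ (q ^ M) / (theta - eps ^+ (q ^ M)).

Lemma sub_emb_e n : x - emb (e ^+ n - e) = theta - eps ^+ n.
Proof. by rewrite rmorphB rmorphXn emb_e opprB addrA addrNK. Qed.

Lemma abs_Omega_factor_sub1 i n : (0 < i)%N ->
  Nkv (Omega_factor (l * n + i) - 1) <= Nkv x ^+ ((q ^ l) ^ n).
Proof.
move=> i0.
have qi : (1 < q ^ i)%N by rewrite -(expn0 q) ltn_exp2l.
(* The general estimate is used with [q ^ l] for [Q] and a single index, the shift varying with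
   [n]. *)
have := @abs_omega_factor_sub1 _ _ _ absN FF emb x (q ^ l) theta_sub_neq0 x_lt1 ql_gt1 unit
  (fun=> q ^ i)%N (fun=> e ^+ (q ^ (l * n + i)) - e) (fun=> qi) tt n.
by rewrite /omega_factor /= sub_emb_e -[((q ^ l) ^ n)%N]expnM -expnD [(i + _)%N]addnC.
Qed.

Lemma abs_Omega_factor_le1 i n : (0 < i)%N -> Nkv (Omega_factor (l * n + i)) <= 1.
Proof.
move=> i0; rewrite -[Omega_factor _](subrK 1); apply: (absD_le absN); last by rewrite (abs1 absN).
by apply: le_trans (abs_Omega_factor_sub1 _ i0) _; rewrite exprn_ile1 // ltW.
Qed.

Lemma Omega_partial_step i n : (0 < i)%N ->
  Nkv (Omega_partial v Nkv j1 l i n.+1 - Omega_partial v Nkv j1 l i n)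
    <= Nkv x ^+ ((q ^ l) ^ n).
Proof.
move=> i0; rewrite /Omega_partial big_nat_recr //= -/(Omega_factor (l * n + i)).
rewrite -[X in _ * _ - X]mulr1 -mulrBr (absM absN).
apply: le_trans (abs_Omega_factor_sub1 n i0); rewrite ler_piMl ?(abs_ge0 absN) //.
rewrite (abs_prod absN); apply: prodr_ile1 => m _.
by rewrite (abs_ge0 absN) abs_Omega_factor_le1.
Qed.

Lemma Omega_tends i : (0 < i)%N ->
  tends_to Nkv (Omega_partial v Nkv j1 l i) (Omega v Nkv j1 l i).
Proof.
move=> i0; apply: lim_absP.
exact: (fast_cauchy_cvg absN x_gt0 x_lt1 ql_gt1 (fun n => Omega_partial_step n i0) compN).
Qed.

Lemma Omega_dist i n : (0 < i)%N ->
  Nkv (Omega v Nkv j1 l i - Omega_partial v Nkv j1 l i n) <= Nkv x ^+ ((q ^ l) ^ n).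
Proof.
move=> i0; exact: (fast_cauchy_lim_dist absN x_gt0 x_lt1 ql_gt1
  (fun n => Omega_partial_step n i0) n (Omega_tends i0)).
Qed.

Lemma Omega_neq0 i : (0 < i)%N -> Omega v Nkv j1 l i != 0.
Proof.
move=> i0; apply/eqP => h; have := Omega_dist 0 i0.
rewrite h /Omega_partial big_nil sub0r (absNE absN) (abs1 absN) expn0 expr1.
by rewrite leNgt x_lt1.
Qed.

Notation pp := (partial_product emb x Q omega_exp omega_shift).

Lemma partial_product_step j s : Nkv (pp j s.+1 - pp j s) <= Nkv x ^+ (Q ^ s).
Proof.
rewrite /partial_product big_ord_recr /= -[X in _ * _ - X]mulr1 -mulrBr (absM absN).
apply: le_trans (abs_omega_factor_sub1 absN emb theta_sub_neq0 x_lt1 Q_gt1 omega_shift omega_exp_gt1 j s).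
rewrite ler_piMl ?(abs_ge0 absN) //.
exact: (abs_partial_product_le1 absN emb theta_sub_neq0 x_lt1 Q_gt1 omega_shift omega_exp_gt1).
Qed.

Definition omega (j : J) : kv := lim_abs Nkv (pp j).

Lemma omega_dist j s : Nkv (omega j - pp j s) <= Nkv x ^+ (Q ^ s).
Proof.
apply: (fast_cauchy_lim_dist absN x_gt0 x_lt1 Q_gt1 (partial_product_step j) s); apply: lim_absP.
exact: (fast_cauchy_cvg absN x_gt0 x_lt1 Q_gt1 (partial_product_step j) compN).
Qed.

(** Write [n = d * m + r0]: the power [Q ^ m] fixes the residue field, so the power of [eps] in the
    denominator does not depend on [m]. *)
Lemma Omega_partial_prod (i : 'I_l) s :
  Omega_partial v Nkv j1 l i.+1 (d * s) = \prod_(r0 < d) pp (i, r0) s.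
Proof.
rewrite /Omega_partial (prod_nat_mul _ _ (fun n => Omega_factor (l * n + i.+1))).
apply: eq_bigr => r0 _; apply: eq_bigr => m _.
have eM : (q ^ (l * (d * m + r0) + i.+1) = omega_exp (i, r0) * Q ^ m)%N.
  by rewrite /omega_exp -expnM -expnD mulnDr mulnA (mulnC l d); congr (_ ^ _)%N; rewrite /=; lia.
rewrite /Omega_factor /omega_factor eM /omega_shift sub_emb_e; congr (1 - _ / (_ - _)).
by rewrite -emb_e -!rmorphXn mulnC exprM frob_residue.
Qed.

Lemma Omega_prod (i : 'I_l) : Omega v Nkv j1 l i.+1 = \prod_(r0 < d) omega (i, r0).
Proof.
apply/eqP; rewrite -subr_eq0; apply/eqP/(fast_eq0 absN x_gt0 x_lt1 Q_gt1) => s.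
rewrite -[Omega _ _ _ _ _](subrK (Omega_partial v Nkv j1 l i.+1 (d * s))) -addrA.
apply: (absD_le absN).
  by have := Omega_dist (d * s) (ltn0Sn i); rewrite -expnM mulnA (mulnC l d) expnM.
have p1 j : Nkv (pp j s) <= 1.
  exact: (abs_partial_product_le1 absN emb theta_sub_neq0 x_lt1 Q_gt1 omega_shift omega_exp_gt1).
have o1 j : Nkv (omega j) <= 1.
  rewrite -[omega j](subrK (pp j s)); apply: (absD_le absN) => //.
  by apply: le_trans (omega_dist j s) _; rewrite exprn_ile1 // ltW.
rewrite Omega_partial_prod.
elim: (index_enum 'I_d) => [|r0 rs IH].
  by rewrite !big_nil subrr (abs0 absN) exprn_ge0 // ltW.
rewrite !big_cons; apply: (abs_mulB_le absN) => //; last by rewrite (absB absN) omega_dist.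
by rewrite (abs_prod absN); apply: prodr_ile1 => r1 _; rewrite (abs_ge0 absN) o1.
Qed.

(** Each [Omega] is a product of [d] of the [omega], so a relation becomes one among the [omega]
    with exponents constant in the second index, after clearing denominators and rewriting the
    coefficients in [x]. *)
Lemma Omega_relation_free (P : mpoly.mpoly l {fraction {poly F}}) :
  \sum_(m <- mpoly.msupp P) j1 (mpoly.mcoeff m P) *
     \prod_(i < l) Omega v Nkv j1 l i.+1 ^+ m i = 0 -> P = 0.
Proof.
move=> rel; apply/eqP/negPn/negP => P0.
pose ms := mpoly.msupp P.
have ms0 : ms != [::] by rewrite mpoly.msupp_eq0.
case eL : (size ms) => [|L]; first by move: ms0; rewrite -size_eq0 eL.
pose m0 := mpoly.mlead P.
pose a (i : 'I_L.+1) := mpoly.mcoeff (nth m0 ms i) P.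
have a0 i : a i != 0 by rewrite -mpoly.mcoeff_msupp mem_nth // -/ms eL.
have [b b0 [p hp]] := common_denominator a.
have [c hc] := fin_all_exists (fun i => lift_poly (p i)).
pose nu (i : 'I_L.+1) (j : J) : nat := (nth m0 ms i) j.1.
pose D := (\max_i \max_j nu i j).+1.
have nu_le i j : (nu i j <= D)%N.
  by apply: leqW; apply: leq_trans (leq_bigmax (F := fun j => nu i j) j)
    (leq_bigmax (F := fun i => \max_j nu i j)%N i).
have p0 i : p i != 0.
  by rewrite -tofrac_eq0 -hp mulf_neq0 // tofrac_eq0.
apply: (@no_relation _ _ _ absN FF emb x Q theta_sub_neq0 x_lt1 Q_gt1 _ _ _ omega_exp omega_shift
   omega_exp_gt1 omega_exp_inj L D nu c nu_le _ _ omega omega_dist) => //.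
- by move=> a1 b1; apply: frob_kv.
- by move=> a1; have := frob_residue a1 1; rewrite expn1.
- move=> i1 i2 h; have h12 : nth m0 ms i1 = nth m0 ms i2.
    (* Distinct monomials stay distinct: the second index 0, available as [d > 0], recovers the
       exponents. *)
    by apply/mpoly.mnmP => i; apply: (h (i, Ordinal deg_gt0)).
  apply/val_inj/eqP; rewrite -(nth_uniq m0 (s := ms)) ?eL ?ltn_ord ?mpoly.msupp_uniq //.
  by rewrite h12.
- move=> i; apply: contraNneq (p0 i) => ci.
  by rewrite -(inj_eq poly_embed_inj) -hc ci !rmorph0.
- have := congr1 (fun z => z * poly_embed b) rel; rewrite mul0r mulr_suml => rel'.
  apply: etrans rel'; rewrite -/ms (big_nth m0) big_mkord eL; apply: eq_bigr => i _.
  rewrite hc mulrAC; congr (_ * _).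
    by rewrite -rmorphM hp.
  rewrite -(pair_bigA _ (fun i0 r0 => omega (i0, r0) ^+ nu i (i0, r0))) /=.
  by apply: eq_bigr => i0 _; rewrite Omega_prod -prodrXl.
by rewrite card_prod !card_ord muln_gt0 l_gt0 deg_gt0.
Qed.

End Factors.
End Omega.

Theorem theorem4p1 (R : realType) (F : finFieldType) (v : {poly F})
  (v_monic : v \is monic) (v_irr : irreducible_poly v)
  (kv : fieldType) (Nkv : kv -> R)
  (j1 : {rmorphism {fraction {poly F}} -> kv})
  (kv_completion : is_completion (vadic_abs R v) Nkv j1)
  (kvbar : closedFieldType) (Nkvbar : kvbar -> R)
  (j2 : {rmorphism kv -> kvbar})
  (kvbar_closure : is_valued_alg_closure Nkv Nkvbar j2)
  (Cv : fieldType) (NCv : Cv -> R)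
  (j3 : {rmorphism kvbar -> Cv})
  (Cv_completion : is_completion Nkvbar NCv j3)
  (l : nat) (l_gt0 : (0 < l)%N) :
  (forall i : nat, (0 < i <= l)%N ->
     tends_to Nkv (Omega_partial v Nkv j1 l i) (Omega v Nkv j1 l i)
     /\ Omega v Nkv j1 l i != 0) /\
  alg_independent_over
    (algebraicOver (fun x : {fraction {poly F}} => j3 (j2 (j1 x))))
    (fun i : 'I_l => j3 (j2 (Omega v Nkv j1 l i.+1))).
Proof.
have [emb [emb_e emb_gF]] :=
  qfpoly_embedding (v_irr, v_monic) (v_teichmuller v_monic v_irr kv_completion).
have cardFF := card_qfpoly (v_irr, v_monic).
split=> [i /andP[i0 _]|P algP Pw].
  split; first exact: (Omega_tends v_monic v_irr kv_completion emb_e l_gt0 i0).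
  exact: (Omega_neq0 v_monic v_irr kv_completion emb_e l_gt0 i0).
pose f : {rmorphism {fraction {poly F}} -> Cv} := (j3 \o (j2 \o j1)).
(* Relations with algebraic coefficients reduce to relations over the rational function field. *)
apply: (@algebraic_independent_descent _ _ f l _ _ P algP Pw) => P' P'w.
apply: (Omega_relation_free v_monic v_irr kv_completion cardFF emb_e emb_gF l_gt0).
apply: (fmorph_inj j2); apply: (fmorph_inj j3); rewrite !rmorph0 !rmorph_sum -[RHS]P'w.
apply: eq_bigr => m _; rewrite !rmorphM !rmorph_prod; congr (_ * _).
by apply: eq_bigr => i _; rewrite !rmorphXn.
Qed.
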